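(* Let $R$ be a commutative ring, let $\varphi\colon A\to B$ be a homomorphism of DG $R$-algebras such that $B$ is semifree as a DG $A$-module, and let $N$ be a semifree DG $B$-module. Let $(\mathbf{B},\mathbf{d})$ be the bar resolution of the DG $B^e$-module $B$, and $\mathbf{d}^N_{n}$ ($n\geq -1$) the maps in the complex $N\otimes_B(\mathbf{B},\mathbf{d})$. The following are equivalent: (i) $N$ is naïvely liftable to $A$; (ii) $\mathbf{d}^N_{-1}\colon N\otimes_AB\to N$ is a splitting DG $B$-module epimorphism (i.e., it has a right inverse that is a DG $B$-module homomorphism); (iii) the complex $N\otimes_B(\mathbf{B},\mathbf{d})$ of DG $B$-modules is split exact, that is, for all integers $n\geq1$, the short exact sequence of DG $B$-modules $$0\to N\otimes_B{}^{n}\!J\to N\otimes_AB^{\otimes_A(n-1)}\otimes_AB\to N\otimes_B{}^{n-1}\!J\to0$$ splits.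
   Context: A DG $R$-algebra means a non-negatively graded, strongly commutative DG $R$-algebra ($aa'=(-1)^{|a||a'|}a'a$ for homogeneous elements, and $a^2=0$ if $|a|$ is odd). DG modules are right DG modules unless otherwise stated. A DG module $P$ over a DG algebra $C$ is semifree if there is a well-ordered subset $F\subseteq P$ which is a basis of the underlying graded $C$-module $P$ such that $\partial^P(f)\in\sum_{e<f}eC$ for every $f\in F$. $B^e=B\otimes_AB$ is the enveloping DG algebra. DG $B^e$-modules are the DG $(B,B)$-bimodules on which the left and right $A$-actions agree up to the Koszul sign. $B^{\otimes_An}$ is the $n$-fold tensor product over $A$, with $B^{\otimes_A0}=A$; for $n\ge 2$ it is a right DG $B^e$-module via $(b_1\otimes_A\cdots\otimes_Ab_n)(b\otimes_Ab')=(-1)^{|b|(|b_2|+\cdots+|b_n|)}b_1b\otimes_Ab_2\otimes_A\cdots\otimes_Ab_nb'$, i.e. left multiplication on the first factor (up to sign) and right multiplication on the last. Bar resolution: let $\mathbf{d}_{-1}\colon B\otimes_AB\to B$ be $b\otimes_Ab'\mapsto bb'$, and for $n\geq1$ let $\mathbf{d}_{n-1}\colon B\otimes_AB^{\otimes_An}\otimes_AB\to B\otimes_AB^{\otimes_A(n-1)}\otimes_AB$ be $$\mathbf{d}_{n-1}(b_0\otimes_A\cdots\otimes_Ab_{n+1})=\sum_{i=0}^n(-1)^ib_0\otimes_A\cdots\otimes_Ab_{i-1}\otimes_Ab_ib_{i+1}\otimes_Ab_{i+2}\otimes_A\cdots\otimes_Ab_{n+1}.$$ The exact complex of DG $B^e$-modules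 $(\mathbf{B},\mathbf{d})=\bigl(\cdots\xrightarrow{\mathbf{d}_1}B^{\otimes_A3}\xrightarrow{\mathbf{d}_0}B^{\otimes_A2}\xrightarrow{\mathbf{d}_{-1}}B\to0\bigr)$ is the bar resolution of $B$. Put ${}^{0}\!J=B$ and ${}^{n}\!J=\operatorname{Ker}\mathbf{d}_{n-2}\subseteq B\otimes_AB^{\otimes_A(n-1)}\otimes_AB$ for $n\geq1$. By exactness ${}^{n}\!J=\operatorname{Im}\mathbf{d}_{n-1}$ for $n\ge 0$, so there are short exact sequences of DG $B^e$-modules $0\to{}^{n}\!J\to B\otimes_AB^{\otimes_A(n-1)}\otimes_AB\xrightarrow{\mathbf{d}_{n-2}}{}^{n-1}\!J\to0$ for $n\geq1$. Applying $N\otimes_B-$ and the identification $N\otimes_B(B\otimes_AB^{\otimes_An}\otimes_AB)\cong N\otimes_AB^{\otimes_An}\otimes_AB$ gives the short exact sequences of DG $B$-modules in (iii) (these remain exact since $N$ is free as a graded $B$-module). With the same identification, $N\otimes_B(\mathbf{B},\mathbf{d})$ is the exact complex $$\cdots\to N\otimes_AB^{\otimes_An}\otimes_AB\xrightarrow{\mathbf{d}^N_{n-1}}\cdots\xrightarrow{\mathbf{d}^N_1}N\otimes_AB^{\otimes_A2}\xrightarrow{\mathbf{d}^N_0}N\otimes_AB\xrightarrow{\mathbf{d}^N_{-1}}N\to0,$$ $\mathbf{d}^N_{n-1}(x\otimes_Ab_1\otimes_A\cdots\otimes_Ab_{n+1})=xb_1\otimes_A\cdots\otimes_Ab_{n+1}+\sum_{i=1}^n(-1)^ix\otimes_Ab_1\otimes_A\cdots\otimes_Ab_ib_{i+1}\otimes_A\cdots\otimes_Ab_{n+1}$;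 in particular $\mathbf{d}^N_{-1}(x\otimes_Ab)=xb$. A semifree DG $B$-module $N$ is naïvely liftable to $A$ if the DG $B$-module epimorphism $\pi_N\colon N|_A\otimes_AB\to N$, $\pi_N(n\otimes b)=nb$, is split (has a right inverse DG $B$-module homomorphism), where $N|_A$ is $N$ viewed as a DG $A$-module via $\varphi$. *)

(* Defs.v *)
From HB Require Import structures.
From mathcomp Require Import all_boot all_order all_algebra.
From mathcomp Require Import boolp classical_sets cardinality fsbigop.

Set Implicit Arguments.
Unset Strict Implicit.
Unset Printing Implicit Defensive.

Import Order.TTheory GRing.Theory Num.Theory.

Local Open Scope ring_scope.
Local Open Scope quotient_scope.

Section MorphD.
Context (U V : zmodType) (f : U -> V) (fD : {morph f : x y / x + y}).

Lemma morphD0 : f 0 = 0.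
Proof. by apply: (@addIr _ (f 0)); rewrite -fD !add0r. Qed.

Lemma morphDN x : f (- x) = - f x.
Proof. by apply: (@addIr _ (f x)); rewrite -fD !addNr morphD0. Qed.

Lemma morphD_sum (I : Type) (s : seq I) (P : pred I) (F : I -> U) :
  f (\sum_(i <- s | P i) F i) = \sum_(i <- s | P i) f (F i).
Proof. exact: (big_morph f fD morphD0). Qed.

Lemma morphDMn x n : f (x *+ n) = f x *+ n.
Proof. by elim: n => [|n IH]; rewrite ?mulr0n ?morphD0 // !mulrS fD IH. Qed.

Lemma morphDMz x n : f (x *~ n) = f x *~ n.
Proof.
case: n => n; first by rewrite -!pmulrn morphDMn.
by rewrite NegzE !mulrNz morphDN -!pmulrn morphDMn.
Qed.

End MorphD.

Lemma N1_exprzD (i j : int) : (-1 : int) ^ (i + j) = (-1) ^ i * (-1) ^ j.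
Proof. by apply: exprzDr; rewrite unitrN unitr1. Qed.

Lemma N1_exprz_sqr (i : int) : (-1 : int) ^ i * (-1) ^ i = 1.
Proof. by rewrite -exprzMl ?unitrN ?unitr1 // mulrNN mulr1 exp1rz. Qed.

Lemma N1_exprzB1 (i : int) : (-1 : int) ^ (i - 1) = - (-1) ^ i.
Proof. by rewrite N1_exprzD -[(-1) ^ (-1)]/(-1) mulrN1. Qed.

Section Tensor.
Context (C : Type) (M L : zmodType) (ra : M -> C -> M) (la : C -> L -> L).

(* A sequence of pairs stands for the formal sum of its members; the zero
   rule together with additivity makes (- m, l) an opposite of (m, l), so the
   quotient of this commutative monoid is the usual quotient of the free
   abelian group on M * L. *)
Inductive tens_eq : seq (M * L) -> seq (M * L) -> Prop :=
| tens_refl s : tens_eq s s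
| tens_sym s t : tens_eq s t -> tens_eq t s
| tens_trans s t u : tens_eq s t -> tens_eq t u -> tens_eq s u
| tens_cat s t s' t' : tens_eq s t -> tens_eq s' t' ->
    tens_eq (s ++ s') (t ++ t')
| tens_comm s t : tens_eq (s ++ t) (t ++ s)
| tens_0l l : tens_eq [:: (0, l)] [::]
| tens_Dl m m' l : tens_eq [:: (m + m', l)] [:: (m, l); (m', l)]
| tens_Dr m l l' : tens_eq [:: (m, l + l')] [:: (m, l); (m, l')]
| tens_bal m c l : tens_eq [:: (ra m c, l)] [:: (m, la c l)].

Definition tens_rel : rel (seq (M * L)) := fun s t => `[< tens_eq s t >].

Lemma tens_rel_refl : reflexive tens_rel.
Proof. by move=> s; apply/asboolP/tens_refl. Qed.

Lemma tens_rel_sym : symmetric tens_rel.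
Proof. by move=> s t; apply/asboolP/asboolP; apply: tens_sym. Qed.

Lemma tens_rel_trans : transitive tens_rel.
Proof.
by move=> s t u /asboolP h1 /asboolP h2; apply/asboolP; apply: tens_trans h1 h2.
Qed.

Canonical tens_equiv := EquivRel tens_rel tens_rel_refl tens_rel_sym tens_rel_trans.
Canonical tens_encModRel := defaultEncModRel tens_rel.

Definition tens : Type := {eq_quot tens_rel}.
HB.instance Definition _ := Quotient.on tens.
HB.instance Definition _ := Choice.on tens.
HB.instance Definition _ : EqQuotient _ tens_rel tens := EqQuotient.on tens.

Definition tens_add (x y : tens) : tens := \pi_tens (repr x ++ repr y).
Definition tens_opp (x : tens) : tens :=
  \pi_tens [seq (- p.1, p.2) | p <- repr x].

Lemma tens_piP s t : reflect (\pi_tens s = \pi_tens t) (`[< tens_eq s t >]).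
Proof. exact: (@eqquotP _ tens_rel tens). Qed.

Lemma tens_pi s t : tens_eq s t -> \pi_tens s = \pi_tens t.
Proof. by move=> h; apply/tens_piP/asboolP. Qed.

Lemma tens_repr s : tens_eq (repr (\pi_tens s)) s.
Proof. by apply/asboolP/tens_piP; rewrite reprK. Qed.

Lemma tens_piD s t : tens_add (\pi_tens s) (\pi_tens t) = \pi_tens (s ++ t).
Proof. by apply: tens_pi; apply: tens_cat; apply: tens_repr. Qed.

Lemma tens_eqN s : tens_eq ([seq (- p.1, p.2) | p <- s] ++ s) [::].
Proof.
elim: s => [|[m l] s IH] /=; first exact: tens_refl.
set S := [seq _ | _ <- s] in IH *.
have h1 : tens_eq (S ++ [:: (m, l)] ++ s) ([:: (m, l)] ++ S ++ s).
  by rewrite !catA; apply: tens_cat (tens_refl s); apply: tens_comm.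
have h2 : tens_eq ([:: (- m, l)] ++ [:: (m, l)]) [::].
  by apply: tens_trans (tens_sym (tens_Dl _ _ _)) _; rewrite addNr; apply: tens_0l.
apply: tens_trans (tens_cat (tens_refl [:: (- m, l)]) h1) _.
by rewrite catA; apply: (tens_cat h2 IH).
Qed.

Lemma tens_addA : associative tens_add.
Proof.
elim/quotW=> s; elim/quotW=> t; elim/quotW=> u.
by rewrite (tens_piD t u) (tens_piD s t) tens_piD tens_piD catA.
Qed.

Lemma tens_addC : commutative tens_add.
Proof. by move=> x y; apply: tens_pi; apply: tens_comm. Qed.

Lemma tens_add0 : left_id (\pi_tens [::]) tens_add.
Proof. by elim/quotW=> s; rewrite tens_piD. Qed.

Lemma tens_addN : left_inverse (\pi_tens [::]) tens_opp tens_add.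
Proof.
move=> x; rewrite -[in X in tens_add _ X](reprK x) tens_piD.
exact/tens_pi/tens_eqN.
Qed.

HB.instance Definition _ :=
  GRing.isZmodule.Build tens tens_addA tens_addC tens_add0 tens_addN.

Definition pure (m : M) (l : L) : tens := \pi_tens [:: (m, l)].

Lemma tens_addE s t : (\pi_tens s : tens) + \pi_tens t = \pi_tens (s ++ t).
Proof. exact: tens_piD. Qed.

Lemma pureDl l : {morph pure^~ l : x y / x + y}.
Proof. by move=> m m'; rewrite tens_addE; apply/tens_pi/tens_Dl. Qed.

Lemma pureDr m : {morph pure m : x y / x + y}.
Proof. by move=> l l'; rewrite tens_addE; apply/tens_pi/tens_Dr. Qed.

Lemma pure_bal m c l : pure (ra m c) l = pure m (la c l).
Proof. exact/tens_pi/tens_bal. Qed.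

Lemma tens_sumE s : \pi_tens s = \sum_(p <- s) pure p.1 p.2.
Proof.
elim: s => [|[m l] s IH]; first by rewrite big_nil.
by rewrite big_cons -IH tens_addE.
Qed.

Lemma tens_ind (P : tens -> Prop) : P 0 -> (forall x y, P x -> P y -> P (x + y)) ->
  (forall m l, P (pure m l)) -> forall x, P x.
Proof.
move=> P0 PD Pp x; rewrite -[x]reprK tens_sumE.
by apply: (big_ind P) => // p _; apply: Pp.
Qed.

(* The map induced by b, provided b is biadditive and balanced. *)
Definition tlift (W : zmodType) (b : M -> L -> W) (x : tens) : W :=
  \sum_(p <- repr x) b p.1 p.2.

Section Lift.
Context (W : zmodType) (b : M -> L -> W).
Hypothesis bDl : forall l, {morph b^~ l : x y / x + y}.
Hypothesis bDr : forall m, {morph b m : x y / x + y}.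
Hypothesis bbal : forall m c l, b (ra m c) l = b m (la c l).

Lemma tlift_eq s t : tens_eq s t ->
  \sum_(p <- s) b p.1 p.2 = \sum_(p <- t) b p.1 p.2.
Proof.
elim=> {s t} //=.
- by move=> s t u _ -> _ ->.
- by move=> s t s' t' _ h _ h'; rewrite !big_cat h h'.
- by move=> s t; rewrite !big_cat /= addrC.
- by move=> l; rewrite big_nil big_seq1 /= (morphD0 (bDl l)).
- by move=> m m' l; rewrite big_seq1 !big_cons big_nil /= bDl addr0.
- by move=> m l l'; rewrite big_seq1 !big_cons big_nil /= bDr addr0.
- by move=> m c l; rewrite !big_seq1 /= bbal.
Qed.

Lemma tliftE m l : tlift b (pure m l) = b m l.
Proof. by rewrite /tlift (tlift_eq (tens_repr _)) big_seq1. Qed.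

Lemma tliftD : {morph tlift b : x y / x + y}.
Proof.
move=> x y; rewrite -[x in LHS]reprK -[y in LHS]reprK tens_addE.
by rewrite /tlift (tlift_eq (tens_repr _)) big_cat.
Qed.

End Lift.
End Tensor.

(* A decomposition of V as the internal direct sum of subgroups V_i, given by
   the projections comp i of V onto V_i. *)
Record isGraded (V : zmodType) (comp : int -> V -> V) : Prop := IsGraded {
  compD : forall i, {morph comp i : x y / x + y};
  comp_comp : forall i j x, comp i (comp j x) = if i == j then comp j x else 0;
  comp_fin : forall x, exists2 s : seq int, uniq s & x = \sum_(i <- s) comp i x }.

(* x belongs to V_i; note that 0 belongs to every V_i. *)
Definition homog (V : zmodType) (comp : int -> V -> V) (i : int) (x : V) : Prop :=
  comp i x = x.

(* \sum_i F i x_i, where x_i is the component of degree i of x; this is a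
   finite sum as soon as F i 0 = 0 for every i. *)
Definition gsum (V W : zmodType) (comp : int -> V -> V) (F : int -> V -> W)
    (x : V) : W :=
  \sum_(i \in [set: int]) F i (comp i x).

Section Graded.
Context (V : zmodType) (comp : int -> V -> V) (grV : isGraded comp).

Lemma comp0 i : comp i 0 = 0.
Proof. exact: (morphD0 (compD grV i)). Qed.

Lemma homog_comp i x : homog comp i (comp i x).
Proof. by rewrite /homog (comp_comp grV) eqxx. Qed.

Lemma homog_compE i j x : homog comp j x -> comp i x = if i == j then x else 0.
Proof. by move=> <-; rewrite (comp_comp grV). Qed.

Lemma homog0 i : homog comp i 0.
Proof. exact: comp0. Qed.

Lemma homogD i x y : homog comp i x -> homog comp i y -> homog comp i (x + y).
Proof. by rewrite /homog (compD grV) => -> ->. Qed.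

Lemma homogMz i x n : homog comp i x -> homog comp i (x *~ n).
Proof. by rewrite /homog (morphDMz (compD grV i)) => ->. Qed.

Lemma comp_supp x : exists2 s : seq int, uniq s &
  forall i, i \notin s -> comp i x = 0.
Proof.
have [s us xs] := comp_fin grV x; exists s => // i nis.
rewrite xs (morphD_sum (compD grV i)) big1_seq // => j /= js.
rewrite (comp_comp grV); case: eqP => // ij; by rewrite ij js in nis.
Qed.

Lemma homog_ind (P : V -> Prop) : P 0 -> (forall x y, P x -> P y -> P (x + y)) ->
  (forall i x, homog comp i x -> P x) -> forall x, P x.
Proof.
move=> P0 PD Ph x; have [s _ ->] := comp_fin grV x.
by apply: (big_ind P) => // i _; apply: (Ph i); apply: homog_comp.
Qed.

Section Gsum.
Context (W : zmodType) (F : int -> V -> W).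
Hypothesis FD : forall i, {morph F i : x y / x + y}.

Lemma gsumE x s : uniq s -> (forall i, i \notin s -> comp i x = 0) ->
  gsum comp F x = \sum_(i <- s) F i (comp i x).
Proof.
move=> us hs; rewrite /gsum (fsbigE s) //=.
  by apply: eq_bigl => i; rewrite in_setT.
move=> i _; case: (boolP (i \in s)) => // /hs ci.
by rewrite ci (morphD0 (FD i)).
Qed.

Lemma gsum_homog p x : homog comp p x -> gsum comp F x = F p x.
Proof.
move=> hx; rewrite (@gsumE _ [:: p]) ?big_seq1 ?hx // => i.
by rewrite inE (homog_compE i hx) => /negbTE ->.
Qed.

Lemma gsumD : {morph gsum comp F : x y / x + y}.
Proof.
move=> x y; have [s us hs] := comp_supp x; have [t ut ht] := comp_supp y.
have U : uniq (undup (s ++ t)) by rewrite undup_uniq.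
have hx i : i \notin undup (s ++ t) -> comp i x = 0.
  by rewrite mem_undup mem_cat negb_or => /andP[/hs].
have hy i : i \notin undup (s ++ t) -> comp i y = 0.
  by rewrite mem_undup mem_cat negb_or => /andP[_ /ht].
rewrite (gsumE U hx) (gsumE U hy) (@gsumE _ (undup (s ++ t))) //.
  by rewrite -big_split; apply: eq_bigr => i _; rewrite (compD grV) FD.
by move=> i hi; rewrite (compD grV) hx // hy // addr0.
Qed.
End Gsum.

Lemma eq_gsum (W : zmodType) (F G : int -> V -> W) : (forall i, F i =1 G i) ->
  gsum comp F =1 gsum comp G.
Proof. by move=> FG x; apply: eq_fsbigr => i _; apply: FG. Qed.

End Graded.

Lemma isGraded_gen (V : zmodType) (comp : int -> V -> V) :
  (forall i, {morph comp i : x y / x + y}) ->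
  (forall P : V -> Prop, P 0 -> (forall x y, P x -> P y -> P (x + y)) ->
    (forall i x, (forall j, comp j x = if j == i then x else 0) -> P x) ->
    forall x, P x) -> isGraded comp.
Proof.
move=> cD ind.
have c0 i : comp i 0 = 0 by apply: (morphD0 (cD i)).
have cc i j x : comp i (comp j x) = if i == j then comp j x else 0.
  move: x; apply: ind.
  - by rewrite !c0 if_same.
  - by move=> x y hx hy; rewrite !cD hx hy; case: eqP => //; rewrite addr0.
  - move=> k x hx; rewrite !hx; case: (j =P k) => [->|]; first exact: hx.
    by rewrite c0 if_same.
split => //.
suff H : forall x, exists2 s : seq int, uniq s &
    forall t, uniq t -> {subset s <= t} -> x = \sum_(i <- t) comp i x.
  by move=> x; have [s us /(_ s us (fun _ => id))] := H x; exists s.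
apply: ind.
- by exists [::] => // t _ _; rewrite big1.
- move=> x y [s us hs] [t ut ht]; exists (undup (s ++ t)); rewrite ?undup_uniq //.
  move=> u uu hu; rewrite (eq_bigr _ (fun i _ => cD i x y)) big_split /=.
  by rewrite -hs -?ht // => i hi; apply: hu; rewrite mem_undup mem_cat hi ?orbT.
- move=> i x hx; exists [:: i] => // t ut ht.
  rewrite (bigD1_seq i) ?ht ?inE //= big1 ?addr0 ?hx ?eqxx // => j /negbTE ji.
  by rewrite hx ji.
Qed.

(* Strongly commutative, non-negatively graded DG R-algebras.  The R-algebra
   structure is given by its structure morphism, whose image is central by
   dga_comm, rather than by algType, which excludes the zero algebra. *)
Record dgAlg (R : comPzRingType) := DGAlg {
  dga_ring :> pzRingType;
  dga_scal : {rmorphism R -> dga_ring};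
  dga_comp : int -> dga_ring -> dga_ring;
  dga_diff : dga_ring -> dga_ring;
  dga_graded : isGraded dga_comp;
  dga_nneg : forall i x, i < 0 -> dga_comp i x = 0;
  dga_scal_homog : forall r, homog dga_comp 0 (dga_scal r);
  dga_mul_homog : forall i j x y, homog dga_comp i x -> homog dga_comp j y ->
    homog dga_comp (i + j) (x * y);
  dga_comm : forall i j x y, homog dga_comp i x -> homog dga_comp j y ->
    x * y = (y * x) *~ (-1) ^ (i * j);
  dga_sqr : forall i x, homog dga_comp i x -> odd `|i|%N -> x * x = 0;
  dga_diffD : {morph dga_diff : x y / x + y};
  dga_diffZ : forall r x, dga_diff (dga_scal r * x) = dga_scal r * dga_diff x;
  dga_diff_homog : forall i x, homog dga_comp i x ->
    homog dga_comp (i - 1) (dga_diff x);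
  dga_diff_diff : forall x, dga_diff (dga_diff x) = 0;
  dga_leibniz : forall i x y, homog dga_comp i x ->
    dga_diff (x * y) = dga_diff x * y + (x * dga_diff y) *~ (-1) ^ i }.

Record dgAlgHom (R : comPzRingType) (A B : dgAlg R) := DGAlgHom {
  dgah_fun :> {rmorphism A -> B};
  dgah_scal : forall r, dgah_fun (dga_scal A r) = dga_scal B r;
  dgah_homog : forall i x, homog (@dga_comp R A) i x ->
    homog (@dga_comp R B) i (dgah_fun x);
  dgah_diff : forall x, dgah_fun (dga_diff x) = dga_diff (dgah_fun x) }.

(* Right DG modules.  The R-module structure is m r := ract m (dga_scal C r);
   dgm_diff is R-linear by dgm_leibniz since dga_diff vanishes on the image
   of R. *)
Record dgMod (R : comPzRingType) (C : dgAlg R) := DGMod {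
  dgm_zmod :> zmodType;
  ract : dgm_zmod -> C -> dgm_zmod;
  dgm_comp : int -> dgm_zmod -> dgm_zmod;
  dgm_diff : dgm_zmod -> dgm_zmod;
  ractDl : forall c, {morph ract^~ c : x y / x + y};
  ractDr : forall x, {morph ract x : c d / c + d};
  ractA : forall x c d, ract (ract x c) d = ract x (c * d);
  ract1 : forall x, ract x 1 = x;
  dgm_graded : isGraded dgm_comp;
  ract_homog : forall i j x c, homog dgm_comp i x -> homog (@dga_comp R C) j c ->
    homog dgm_comp (i + j) (ract x c);
  dgm_diffD : {morph dgm_diff : x y / x + y};
  dgm_diff_homog : forall i x, homog dgm_comp i x ->
    homog dgm_comp (i - 1) (dgm_diff x);
  dgm_diff_diff : forall x, dgm_diff (dgm_diff x) = 0;
  dgm_leibniz : forall i x c, homog dgm_comp i x ->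
    dgm_diff (ract x c) = ract (dgm_diff x) c + ract x (dga_diff c) *~ (-1) ^ i }.

Record dgBimod (R : comPzRingType) (C D : dgAlg R) := DGBimod {
  dgb_mod :> dgMod D;
  lact : C -> dgb_mod -> dgb_mod;
  lactDl : forall x, {morph lact^~ x : c d / c + d};
  lactDr : forall c, {morph lact c : x y / x + y};
  lactA : forall c d x, lact c (lact d x) = lact (c * d) x;
  lact1 : forall x, lact 1 x = x;
  lact_ract : forall c x d, lact c (ract x d) = ract (lact c x) d;
  lact_homog : forall i j c x, homog (@dga_comp R C) i c ->
    homog (@dgm_comp R D dgb_mod) j x ->
    homog (@dgm_comp R D dgb_mod) (i + j) (lact c x);
  lact_leibniz : forall i c x, homog (@dga_comp R C) i c ->
    dgm_diff (lact c x) = lact (dga_diff c) x + lact c (dgm_diff x) *~ (-1) ^ i }.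

Record dgHom (R : comPzRingType) (C : dgAlg R) (M N : dgMod C) := DGHom {
  dgh_fun :> M -> N;
  dghD : {morph dgh_fun : x y / x + y};
  dgh_ract : forall x c, dgh_fun (ract x c) = ract (dgh_fun x) c;
  dgh_homog : forall i x, homog (@dgm_comp R C M) i x ->
    homog (@dgm_comp R C N) i (dgh_fun x);
  dgh_diff : forall x, dgh_fun (dgm_diff x) = dgm_diff (dgh_fun x) }.

Section Semifree.
Context (R : comPzRingType) (C : dgAlg R) (P : dgMod C).

Definition in_span (X : set P) (y : P) : Prop :=
  exists s : seq (P * C), (forall p, p \in s -> X p.1) /\
    y = \sum_(p <- s) ract p.1 p.2.

(* A basis of a graded module consists of homogeneous elements. *)
Definition graded_basis (F : set P) : Prop :=
  [/\ forall f, F f -> exists i, homog (@dgm_comp R C P) i f,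
      forall y, in_span F y &
      forall (s : seq P) (c : P -> C), uniq s -> (forall f, f \in s -> F f) ->
        \sum_(f <- s) ract f (c f) = 0 -> forall f, f \in s -> c f = 0].

Definition well_orders (F : set P) (lt : P -> P -> Prop) : Prop :=
  [/\ forall e, F e -> ~ lt e e,
      forall e f g, F e -> F f -> F g -> lt e f -> lt f g -> lt e g,
      forall e f, F e -> F f -> [\/ lt e f, e = f | lt f e] &
      forall X : set P, (X `<=` F)%classic -> (exists x, X x) ->
        exists2 x, X x & forall y, X y -> ~ lt y x].

Definition semifree : Prop :=
  exists (F : set P) (lt : P -> P -> Prop),
    [/\ graded_basis F, well_orders F lt &
        forall f, F f -> in_span (fun e => F e /\ lt e f) (dgm_diff f)].

End Semifree.

Section Split.
Context (R : comPzRingType) (C : dgAlg R).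

Definition split_epi (M N : dgMod C) (g : dgHom M N) : Prop :=
  exists s : dgHom N M, forall y, g (s y) = y.

Definition short_exact (L M N : dgMod C) (f : dgHom L M) (g : dgHom M N) : Prop :=
  [/\ injective f, forall y, g y = 0 <-> exists x, f x = y &
      forall z, exists y, g y = z].

Definition splits (L M N : dgMod C) (f : dgHom L M) (g : dgHom M N) : Prop :=
  short_exact f g /\ split_epi g.

End Split.

Section Regular.
Context (R : comPzRingType) (B : dgAlg R).

Lemma dga1_homog : homog (@dga_comp R B) 0 1.
Proof. by rewrite -(rmorph1 (dga_scal B)); apply: dga_scal_homog. Qed.

Lemma reg_ractDl (c : B) : {morph (fun x : B => x * c) : x y / x + y}.
Proof. by move=> x y; rewrite mulrDl. Qed.

Lemma reg_ractDr (x : B) : {morph (fun c : B => x * c) : c d / c + d}.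
Proof. by move=> c d; rewrite mulrDr. Qed.

Definition regMod : dgMod B :=
  @DGMod R B B (fun x c => x * c) (@dga_comp R B) (@dga_diff R B)
    reg_ractDl reg_ractDr (fun x c d => esym (mulrA x c d)) (@mulr1 B)
    (dga_graded B) (@dga_mul_homog R B) (@dga_diffD R B) (@dga_diff_homog R B)
    (@dga_diff_diff R B) (@dga_leibniz R B).

End Regular.

Section BaseChange.
Context (R : comPzRingType) (A B : dgAlg R) (phi : dgAlgHom A B).

(* N|_A *)
Section Restriction.
Context (N : dgMod B).

Lemma res_ractDr (x : N) : {morph (fun a => ract x (phi a)) : c d / c + d}.
Proof. by move=> c d; rewrite rmorphD ractDr. Qed.

Lemma res_ractA (x : N) (c d : A) :
  ract (ract x (phi c)) (phi d) = ract x (phi (c * d)).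
Proof. by rewrite rmorphM ractA. Qed.

Lemma res_ract1 (x : N) : ract x (phi 1) = x.
Proof. by rewrite rmorph1 ract1. Qed.

Lemma res_ract_homog i j (x : N) (c : A) : homog (@dgm_comp R B N) i x ->
  homog (@dga_comp R A) j c -> homog (@dgm_comp R B N) (i + j) (ract x (phi c)).
Proof. by move=> hx hc; apply: ract_homog => //; apply: dgah_homog. Qed.

Lemma res_leibniz i (x : N) (c : A) : homog (@dgm_comp R B N) i x ->
  dgm_diff (ract x (phi c)) =
    ract (dgm_diff x) (phi c) + ract x (phi (dga_diff c)) *~ (-1) ^ i.
Proof. by move=> hx; rewrite (dgm_leibniz _ hx) dgah_diff. Qed.

Definition resMod : dgMod A :=
  @DGMod R A N (fun x a => ract x (phi a)) (@dgm_comp R B N) (@dgm_diff R B N)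
    (fun a => @ractDl R B N (phi a)) res_ractDr res_ractA res_ract1
    (dgm_graded N) res_ract_homog (@dgm_diffD R B N) (@dgm_diff_homog R B N)
    (@dgm_diff_diff R B N) res_leibniz.
End Restriction.

Lemma phi_lactDl (x : regMod B) : {morph (fun a => phi a * x) : c d / c + d}.
Proof. by move=> c d; rewrite rmorphD mulrDl. Qed.

Lemma phi_lactDr (a : A) : {morph (fun x : regMod B => phi a * x) : x y / x + y}.
Proof. by move=> x y; rewrite mulrDr. Qed.

Lemma phi_lactA (c d : A) (x : regMod B) : phi c * (phi d * x) = phi (c * d) * x.
Proof. by rewrite rmorphM mulrA. Qed.

Lemma phi_lact1 (x : regMod B) : phi 1 * x = x.
Proof. by rewrite rmorph1 mul1r. Qed.

Lemma phi_lact_ract (c : A) (x : regMod B) (d : B) :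
  phi c * ract x d = ract (phi c * x : regMod B) d.
Proof. exact: mulrA. Qed.

Lemma phi_lact_homog i j (c : A) (x : regMod B) : homog (@dga_comp R A) i c ->
  homog (@dgm_comp R B (regMod B)) j x ->
  homog (@dgm_comp R B (regMod B)) (i + j) (phi c * x).
Proof. by move=> hc hx; apply: dga_mul_homog => //; apply: dgah_homog. Qed.

Lemma phi_lact_leibniz i (c : A) (x : regMod B) : homog (@dga_comp R A) i c ->
  dgm_diff (phi c * x : regMod B) =
    phi (dga_diff c) * x + (phi c * dgm_diff x) *~ (-1) ^ i :> regMod B.
Proof.
by move=> hc; rewrite dgah_diff; apply: dga_leibniz; apply: dgah_homog.
Qed.

(* B as a DG (A, B)-bimodule via phi *)
Definition phiBimod : dgBimod A B :=
  @DGBimod R A B (regMod B) (fun a x => phi a * x) phi_lactDl phi_lactDr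
    phi_lactA phi_lact1 phi_lact_ract phi_lact_homog phi_lact_leibniz.

End BaseChange.

Section TensorDG.
Context (R : comPzRingType) (C D : dgAlg R) (M : dgMod C) (L : dgBimod C D).

Local Notation T := (tens (@ract R C M) (@lact R C D L)).
Local Notation "m ⊗ l" := (pure (@ract R C M) (@lact R C D L) m l)
  (at level 40, left associativity).
Local Notation hM := (homog (@dgm_comp R C M)).
Local Notation hL := (homog (@dgm_comp R D L)).
Local Notation grM := (dgm_graded M).
Local Notation grL := (dgm_graded L).

(* The component of degree k of m ⊗ l is \sum_i m_i ⊗ l_(k - i). *)
Definition tens_comp (k : int) : T -> T :=
  tlift (fun m l => gsum (@dgm_comp R C M)
    (fun i x => x ⊗ dgm_comp (k - i) l) m).

(* d(m ⊗ l) = d m ⊗ l + \sum_i (-1)^i m_i ⊗ d l *)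
Definition tens_diff : T -> T :=
  tlift (fun m l => dgm_diff m ⊗ l +
    gsum (@dgm_comp R C M) (fun i x => (x ⊗ dgm_diff l) *~ (-1) ^ i) m).

Definition tens_ract (t : T) (d : D) : T :=
  tlift (fun m l => m ⊗ ract l d) t.

Let pl (l : L) : {morph (fun m : M => m ⊗ l) : x y / x + y} := pureDl _ _ l.
Let pr (m : M) : {morph (fun l : L => m ⊗ l) : x y / x + y} := pureDr _ _ m.

Let c1D k l i : {morph (fun x : M => x ⊗ dgm_comp (k - i) l) : x y / x + y}.
Proof. exact: pl. Qed.

Let d1D l i : {morph (fun x : M => (x ⊗ dgm_diff l) *~ (-1) ^ i) : x y / x + y}.
Proof. by move=> x y; rewrite pl mulrzDl. Qed.

Lemma gsumDr (W : zmodType) (F G : int -> M -> W) (m : M) :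
  (forall i, {morph F i : x y / x + y}) ->
  (forall i, {morph G i : x y / x + y}) ->
  gsum (@dgm_comp R C M) (fun i x => F i x + G i x) m =
  gsum (@dgm_comp R C M) F m + gsum (@dgm_comp R C M) G m.
Proof.
move=> FD GD; have [s us hs] := comp_supp grM m.
rewrite (gsumE FD us hs) (gsumE GD us hs) (gsumE _ us hs) ?big_split //.
by move=> i x y; rewrite FD GD addrACA.
Qed.

Section Comp.
Context (k : int).
Local Notation b := (fun m l => gsum (@dgm_comp R C M)
    (fun i x => x ⊗ dgm_comp (k - i) l) m).

Let bDl l : {morph b^~ l : x y / x + y}.
Proof. by move=> x y; apply: (gsumD grM (c1D k l)). Qed.

Let bDr m : {morph b m : x y / x + y}.
Proof.
move=> x y; rewrite -gsumDr; try exact: c1D.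
by apply: eq_gsum => i z; rewrite (compD grL) pr.
Qed.

Let b_homog p q m l : hM p m -> hL q l -> b m l = if k == p + q then m ⊗ l else 0.
Proof.
move=> hm hl; rewrite /= (gsum_homog grM (c1D k l) hm) (homog_compE grL _ hl).
by rewrite subr_eq [q + p]addrC; case: eqP => // _; rewrite (morphD0 (pr m)).
Qed.

Let bbal m c l : b (ract m c) l = b m (lact c l).
Proof.
move: m; apply: (homog_ind grM).
- by rewrite (morphD0 (ractDl c)) !(morphD0 (bDl _)).
- by move=> x y hx hy; rewrite (ractDl c) !bDl hx hy.
move=> p m hm; move: c; apply: (homog_ind (dga_graded C)).
- by rewrite (morphD0 (ractDr m)) (morphD0 (lactDl l)) (morphD0 (bDl _))
    (morphD0 (bDr _)).
- by move=> x y hx hy; rewrite (ractDr m) bDl (lactDl l) bDr hx hy.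
move=> r c hc; move: l; apply: (homog_ind grL).
- by rewrite (morphD0 (lactDr c)) !(morphD0 (bDr _)).
- by move=> x y hx hy; rewrite (lactDr c) !bDr hx hy.
move=> q l hl; rewrite (b_homog (ract_homog hm hc) hl).
by rewrite (b_homog hm (lact_homog hc hl)) addrA pure_bal.
Qed.

Lemma tens_compD : {morph tens_comp k : x y / x + y}.
Proof. exact: (tliftD bDl bDr bbal). Qed.

Lemma tens_comp_pure p q m l : hM p m -> hL q l ->
  tens_comp k (m ⊗ l) = if k == p + q then m ⊗ l else 0.
Proof. by move=> hm hl; rewrite /tens_comp (tliftE bDl bDr bbal) (b_homog hm hl). Qed.

End Comp.

Lemma tens_hind (P : T -> Prop) : P 0 -> (forall x y, P x -> P y -> P (x + y)) ->
  (forall p q m l, hM p m -> hL q l -> P (m ⊗ l)) -> forall x, P x.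
Proof.
move=> P0 PD Ph; apply: tens_ind => // m l.
move: m; apply: (homog_ind grM); first by rewrite (morphD0 (pl l)).
  by move=> x y hx hy; rewrite pl; apply: PD.
move=> p m hm; move: l; apply: (homog_ind grL); first by rewrite (morphD0 (pr m)).
  by move=> x y hx hy; rewrite pr; apply: PD.
by move=> q l hl; apply: Ph hm hl.
Qed.

Lemma tens_graded : isGraded tens_comp.
Proof.
apply: isGraded_gen; first exact: tens_compD.
move=> P P0 PD Ph; apply: tens_hind => // p q m l hm hl.
by apply: (Ph (p + q)) => j; apply: tens_comp_pure.
Qed.

Lemma pure_homog p q m l : hM p m -> hL q l -> homog tens_comp (p + q) (m ⊗ l).
Proof. by move=> hm hl; rewrite /homog (tens_comp_pure _ hm hl) eqxx. Qed.

Lemma tens_homog_ind (W : zmodType) (cW : int -> W -> W) (f : T -> W) (e : int) :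
  isGraded cW -> {morph f : x y / x + y} ->
  (forall p q m l, hM p m -> hL q l -> homog cW (p + q + e) (f (m ⊗ l))) ->
  forall i x, homog tens_comp i x -> homog cW (i + e) (f x).
Proof.
move=> grW fD fh i x <-; move: x; apply: tens_hind.
- by rewrite (morphD0 (tens_compD i)) (morphD0 fD); apply: homog0.
- by move=> x y hx hy; rewrite tens_compD fD; apply: homogD.
move=> p q m l hm hl; rewrite (tens_comp_pure i hm hl).
by case: eqP => [->|_]; [apply: fh | rewrite (morphD0 fD); apply: homog0].
Qed.

Section Ract.
Context (d : D).
Local Notation b := (fun m l => m ⊗ ract l d).

Let bDl l : {morph b^~ l : x y / x + y}.
Proof. exact: pl. Qed.

Let bDr m : {morph b m : x y / x + y}.
Proof. by move=> x y; rewrite (ractDl d) pr. Qed.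

Let bbal m c l : b (ract m c) l = b m (lact c l).
Proof. by rewrite /= pure_bal lact_ract. Qed.

Lemma tens_ractDl : {morph tens_ract^~ d : x y / x + y}.
Proof. exact: (tliftD bDl bDr bbal). Qed.

Lemma tens_ract_pure m l : tens_ract (m ⊗ l) d = m ⊗ ract l d.
Proof. exact: (tliftE bDl bDr bbal). Qed.

End Ract.

Lemma tens_ractDr t : {morph tens_ract t : c d / c + d}.
Proof.
move=> c d; move: t; apply: tens_ind.
- by rewrite !(morphD0 (tens_ractDl _)) addr0.
- by move=> x y hx hy; rewrite !tens_ractDl hx hy addrACA.
- by move=> m l; rewrite !tens_ract_pure (ractDr l) pr.
Qed.

Lemma tens_ractA t c d : tens_ract (tens_ract t c) d = tens_ract t (c * d).
Proof.
move: t; apply: tens_ind.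
- by rewrite !(morphD0 (tens_ractDl _)).
- by move=> x y hx hy; rewrite !tens_ractDl hx hy.
- by move=> m l; rewrite !tens_ract_pure ractA.
Qed.

Lemma tens_ract1 t : tens_ract t 1 = t.
Proof.
move: t; apply: tens_ind.
- by rewrite !(morphD0 (tens_ractDl _)).
- by move=> x y hx hy; rewrite !tens_ractDl hx hy.
- by move=> m l; rewrite !tens_ract_pure ract1.
Qed.

Lemma tens_ract_homog i j t d : homog tens_comp i t -> homog (@dga_comp R D) j d ->
  homog tens_comp (i + j) (tens_ract t d).
Proof.
move=> ht hd; move: i t ht; apply: (tens_homog_ind tens_graded (tens_ractDl d)).
move=> p q m l hm hl; rewrite tens_ract_pure -addrA.
by apply: pure_homog => //; apply: ract_homog.
Qed.

Section Diff.
Local Notation b := (fun m l => dgm_diff m ⊗ l +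
    gsum (@dgm_comp R C M) (fun i x => (x ⊗ dgm_diff l) *~ (-1) ^ i) m).

Let bDl l : {morph b^~ l : x y / x + y}.
Proof.
by move=> x y /=; rewrite dgm_diffD pl (gsumD grM (d1D l)) addrACA.
Qed.

Let bDr m : {morph b m : x y / x + y}.
Proof.
move=> x y; rewrite pr addrACA -gsumDr; try exact: d1D.
by congr (_ + _); apply: eq_gsum => i z; rewrite dgm_diffD pr mulrzDl.
Qed.

Let b_homog p m l : hM p m ->
  b m l = dgm_diff m ⊗ l + (m ⊗ dgm_diff l) *~ (-1) ^ p.
Proof. by move=> hm; rewrite /= (gsum_homog grM (d1D l) hm). Qed.

Let bbal m c l : b (ract m c) l = b m (lact c l).
Proof.
move: m; apply: (homog_ind grM).
- by rewrite (morphD0 (ractDl c)) !(morphD0 (bDl _)).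
- by move=> x y hx hy; rewrite (ractDl c) !bDl hx hy.
move=> p m hm; move: c; apply: (homog_ind (dga_graded C)).
- by rewrite (morphD0 (ractDr m)) (morphD0 (lactDl l)) (morphD0 (bDl _))
    (morphD0 (bDr _)).
- by move=> x y hx hy; rewrite (ractDr m) bDl (lactDl l) bDr hx hy.
move=> r c hc; rewrite (b_homog _ (ract_homog hm hc)) (b_homog _ hm).
rewrite (dgm_leibniz _ hm) (lact_leibniz _ hc) pl (morphDMz (pl l)) !pure_bal.
rewrite pr mulrzDl (morphDMz (pr m)) -mulrzA -N1_exprzD [r + p]addrC.
by rewrite addrA.
Qed.

Lemma tens_diffD : {morph tens_diff : x y / x + y}.
Proof. exact: (tliftD bDl bDr bbal). Qed.

Lemma tens_diff_pure p m l : hM p m ->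
  tens_diff (m ⊗ l) = dgm_diff m ⊗ l + (m ⊗ dgm_diff l) *~ (-1) ^ p.
Proof. by move=> hm; rewrite /tens_diff (tliftE bDl bDr bbal) (b_homog _ hm). Qed.

End Diff.

Lemma tens_diff_homog i t : homog tens_comp i t ->
  homog tens_comp (i - 1) (tens_diff t).
Proof.
move: i t; apply: (tens_homog_ind tens_graded tens_diffD) => p q m l hm hl.
rewrite (tens_diff_pure _ hm); apply: (homogD tens_graded).
  by rewrite addrAC; apply: pure_homog => //; apply: dgm_diff_homog.
apply: (homogMz tens_graded); rewrite -addrA.
by apply: pure_homog => //; apply: dgm_diff_homog.
Qed.

Lemma tens_diff_diff t : tens_diff (tens_diff t) = 0.
Proof.
move: t; apply: tens_hind.
- by rewrite !(morphD0 tens_diffD).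
- by move=> x y hx hy; rewrite !tens_diffD hx hy addr0.
move=> p q m l hm hl; rewrite (tens_diff_pure _ hm) tens_diffD.
rewrite (morphDMz tens_diffD) (tens_diff_pure _ hm).
rewrite (tens_diff_pure _ (dgm_diff_homog hm)) !dgm_diff_diff.
rewrite (morphD0 (pl l)) (morphD0 (pr m)) mul0rz addr0 add0r.
by rewrite N1_exprzB1 mulrNz addNr.
Qed.

Lemma tens_leibniz i t d : homog tens_comp i t ->
  tens_diff (tens_ract t d) =
    tens_ract (tens_diff t) d + tens_ract t (dga_diff d) *~ (-1) ^ i.
Proof.
move=> <-; move: t; apply: tens_hind.
- rewrite !(morphD0 (tens_compD i)) !(morphD0 (tens_ractDl _)).
  by rewrite !(morphD0 tens_diffD) (morphD0 (tens_ractDl _)) mul0rz addr0.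
- move=> x y hx hy; rewrite !tens_compD !tens_ractDl !tens_diffD !tens_ractDl.
  by rewrite hx hy mulrzDl addrACA.
move=> p q m l hm hl; rewrite (tens_comp_pure i hm hl).
case: (i =P p + q) => [->|_]; last first.
  rewrite !(morphD0 (tens_ractDl _)) !(morphD0 tens_diffD).
  by rewrite (morphD0 (tens_ractDl _)) mul0rz addr0.
rewrite !tens_ract_pure !(tens_diff_pure _ hm) tens_ractDl.
rewrite (morphDMz (tens_ractDl d)) !tens_ract_pure (dgm_leibniz _ hl).
rewrite pr (morphDMz (pr m)) mulrzDl -mulrzA -N1_exprzD [q + p]addrC.
by rewrite addrA.
Qed.

Definition tensor : dgMod D :=
  @DGMod R D T tens_ract tens_comp tens_diff tens_ractDl tens_ractDr tens_ractA
    tens_ract1 tens_graded tens_ract_homog tens_diffD tens_diff_homog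
    tens_diff_diff tens_leibniz.

Definition ptens (m : M) (l : L) : tensor := m ⊗ l.

End TensorDG.

Section HomLemmas.
Context (R : comPzRingType) (C : dgAlg R).

Lemma dgh_comp (M N : dgMod C) (f : dgHom M N) i x :
  f (dgm_comp i x) = dgm_comp i (f x).
Proof.
move: x; apply: (homog_ind (dgm_graded M)).
- by rewrite (morphD0 (dghD f)) !(comp0 (dgm_graded _)) (morphD0 (dghD f)).
- by move=> x y hx hy; rewrite (compD (dgm_graded M)) !(dghD f)
    (compD (dgm_graded N)) hx hy.
move=> p x hx; rewrite (homog_compE (dgm_graded M) i hx).
rewrite (homog_compE (dgm_graded N) i (dgh_homog f hx)).
by case: eqP => // _; rewrite (morphD0 (dghD f)).
Qed.

Section Comp.
Context (L M N : dgMod C) (g : dgHom M N) (f : dgHom L M).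

Lemma dgcompD : {morph (fun x => g (f x)) : x y / x + y}.
Proof. by move=> x y; rewrite !dghD. Qed.

Lemma dgcomp_ract x c : g (f (ract x c)) = ract (g (f x)) c.
Proof. by rewrite !dgh_ract. Qed.

Lemma dgcomp_homog i x : homog (@dgm_comp R C L) i x ->
  homog (@dgm_comp R C N) i (g (f x)).
Proof. by move=> hx; do 2!apply: dgh_homog. Qed.

Lemma dgcomp_diff x : g (f (dgm_diff x)) = dgm_diff (g (f x)).
Proof. by rewrite !dgh_diff. Qed.

Definition dgcomp : dgHom L N :=
  DGHom dgcompD dgcomp_ract dgcomp_homog dgcomp_diff.
End Comp.

End HomLemmas.

Record dgbHom (R : comPzRingType) (C D : dgAlg R) (M N : dgBimod C D) := DGBHom {
  dgbh_hom :> dgHom M N;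
  dgbh_lact : forall c x, dgbh_hom (lact c x) = lact c (dgbh_hom x) }.

Definition rlinear (R : comPzRingType) (C : dgAlg R) (M N : dgMod C)
    (h : M -> N) : Prop :=
  {morph h : x y / x + y} /\ forall x c, h (ract x c) = ract (h x) c.

Definition llinear (R : comPzRingType) (C D : dgAlg R) (M N : dgBimod C D)
    (h : M -> N) : Prop :=
  {morph h : x y / x + y} /\ forall c x, h (lact c x) = lact c (h x).

Lemma dgh_rlinear (R : comPzRingType) (C : dgAlg R) (M N : dgMod C)
  (f : dgHom M N) : rlinear f.
Proof. by split; [apply: dghD | apply: dgh_ract]. Qed.

Lemma dgbh_llinear (R : comPzRingType) (C D : dgAlg R) (M N : dgBimod C D)
  (f : dgbHom M N) : llinear f.
Proof. by split; [apply: dghD | apply: dgbh_lact]. Qed.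

Section TensorMap.
Context (R : comPzRingType) (C D : dgAlg R).

Section Pure.
Context (M : dgMod C) (L : dgBimod C D).

Lemma ptensDl (l : L) : {morph (fun m : M => ptens m l) : x y / x + y}.
Proof. exact: pureDl. Qed.

Lemma ptensDr (m : M) : {morph (fun l : L => ptens m l) : x y / x + y}.
Proof. exact: pureDr. Qed.

Lemma ptens_bal (m : M) c (l : L) : ptens (ract m c) l = ptens m (lact c l).
Proof. exact: pure_bal. Qed.

Lemma ptens_ract (m : M) (l : L) d : ract (ptens m l) d = ptens m (ract l d).
Proof. exact: tens_ract_pure. Qed.

Lemma ptens_homog p q (m : M) (l : L) : homog (@dgm_comp R C M) p m ->
  homog (@dgm_comp R D L) q l ->
  homog (@dgm_comp R D (tensor M L)) (p + q) (ptens m l).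
Proof. exact: pure_homog. Qed.

Lemma ptens_diff p (m : M) (l : L) : homog (@dgm_comp R C M) p m ->
  dgm_diff (ptens m l) =
    ptens (dgm_diff m) l + (ptens m (dgm_diff l)) *~ (-1) ^ p.
Proof. exact: tens_diff_pure. Qed.

Lemma tensor_ind (P : tensor M L -> Prop) : P 0 ->
  (forall x y, P x -> P y -> P (x + y)) ->
  (forall m l, P (ptens m l)) -> forall x, P x.
Proof. exact: tens_ind. Qed.

Lemma tensor_hind (P : tensor M L -> Prop) : P 0 ->
  (forall x y, P x -> P y -> P (x + y)) ->
  (forall p q m l, homog (@dgm_comp R C M) p m -> homog (@dgm_comp R D L) q l ->
    P (ptens m l)) -> forall x, P x.
Proof. exact: tens_hind. Qed.

Lemma tensor_homog_ind (W : zmodType) (cW : int -> W -> W)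
  (f : tensor M L -> W) (e : int) :
  isGraded cW -> {morph f : x y / x + y} ->
  (forall p q m l, homog (@dgm_comp R C M) p m -> homog (@dgm_comp R D L) q l ->
    homog cW (p + q + e) (f (ptens m l))) ->
  forall i x, homog (@dgm_comp R D (tensor M L)) i x -> homog cW (i + e) (f x).
Proof. exact: tens_homog_ind. Qed.

Lemma tensor_eq (W : zmodType) (f g : tensor M L -> W) :
  {morph f : x y / x + y} -> {morph g : x y / x + y} ->
  (forall m l, f (ptens m l) = g (ptens m l)) -> f =1 g.
Proof.
move=> fD gD fg; apply: tensor_ind => //.
- by rewrite (morphD0 fD) (morphD0 gD).
- by move=> x y hx hy; rewrite fD gD hx hy.
Qed.

(* The map induced by b : M -> L -> W, biadditive and C-balanced *)
Definition tensor_lift (W : zmodType) (b : M -> L -> W) : tensor M L -> W :=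
  tlift b.

Section Lift.
Context (W : zmodType) (b : M -> L -> W).
Hypothesis bDl : forall l, {morph b^~ l : x y / x + y}.
Hypothesis bDr : forall m, {morph b m : x y / x + y}.
Hypothesis bbal : forall m c l, b (ract m c) l = b m (lact c l).

Lemma tensor_liftE m l : tensor_lift b (ptens m l) = b m l.
Proof. exact: (tliftE bDl bDr bbal). Qed.

Lemma tensor_liftD : {morph tensor_lift b : x y / x + y}.
Proof. exact: (tliftD bDl bDr bbal). Qed.
End Lift.

Section LiftHom.
Context (W : dgMod D) (b : M -> L -> W).
Hypothesis bDl : forall l, {morph b^~ l : x y / x + y}.
Hypothesis bDr : forall m, {morph b m : x y / x + y}.
Hypothesis bbal : forall m c l, b (ract m c) l = b m (lact c l).
Hypothesis bract : forall m l d, b m (ract l d) = ract (b m l) d.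
Hypothesis bhomog : forall p q m l, homog (@dgm_comp R C M) p m ->
  homog (@dgm_comp R D L) q l -> homog (@dgm_comp R D W) (p + q) (b m l).
Hypothesis bdiff : forall p m l, homog (@dgm_comp R C M) p m ->
  b (dgm_diff m) l + b m (dgm_diff l) *~ (-1) ^ p = dgm_diff (b m l).

Lemma tensor_lift_ract t d :
  tensor_lift b (ract t d) = ract (tensor_lift b t) d.
Proof.
have lD := tensor_liftD bDl bDr bbal.
apply: (tensor_eq (f := fun t => tensor_lift b (ract t d))
                  (g := fun t => ract (tensor_lift b t) d)).
- by move=> x y; rewrite (ractDl d) lD.
- by move=> x y; rewrite lD (ractDl d).
by move=> m l; rewrite ptens_ract !(tensor_liftE bDl bDr bbal) bract.
Qed.

Lemma tensor_lift_homog i t : homog (@dgm_comp R D (tensor M L)) i t ->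
  homog (@dgm_comp R D W) i (tensor_lift b t).
Proof.
rewrite -[X in _ -> homog _ X _]addr0; move: i t.
apply: (tensor_homog_ind (dgm_graded W) (tensor_liftD bDl bDr bbal)).
move=> p q m l hm hl.
by rewrite addr0 (tensor_liftE bDl bDr bbal); apply: bhomog.
Qed.

Lemma tensor_lift_diff t :
  tensor_lift b (dgm_diff t) = dgm_diff (tensor_lift b t).
Proof.
have lD := tensor_liftD bDl bDr bbal.
move: t; apply: tensor_hind.
- by rewrite !(morphD0 (@dgm_diffD R D _)) (morphD0 lD) (morphD0 (@dgm_diffD R D _)).
- by move=> x y hx hy; rewrite lD !dgm_diffD lD hx hy.
move=> p q m l hm hl; rewrite (ptens_diff _ hm) lD (morphDMz lD).
by rewrite !(tensor_liftE bDl bDr bbal) (bdiff _ hm).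
Qed.

Definition tensor_liftH : dgHom (tensor M L) W :=
  DGHom (tensor_liftD bDl bDr bbal) tensor_lift_ract tensor_lift_homog
    tensor_lift_diff.
End LiftHom.

End Pure.

(* h ⊗ L *)
Section MapL.
Context (M M' : dgMod C) (L : dgBimod C D).

Definition tmapl (h : M -> M') : tensor M L -> tensor M' L :=
  tensor_lift (fun m l => ptens (h m) l).

Section Linear.
Context (h : M -> M') (hlin : rlinear h).
Local Notation b := (fun m l => ptens (h m) l : tensor M' L).

Let bDl l : {morph b^~ l : x y / x + y}.
Proof. by move=> x y; rewrite hlin.1 ptensDl. Qed.
Let bDr m : {morph b m : x y / x + y}.
Proof. exact: ptensDr. Qed.
Let bbal m c l : b (ract m c) l = b m (lact c l).
Proof. by rewrite /= hlin.2 ptens_bal. Qed.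

Lemma tmapl_pure m l : tmapl h (ptens m l) = ptens (h m) l.
Proof. exact: (tensor_liftE bDl bDr bbal). Qed.

Lemma tmapl_rlinear : rlinear (tmapl h).
Proof.
split; first exact: (tensor_liftD bDl bDr bbal).
by apply: (tensor_lift_ract bDl bDr bbal) => m l d; rewrite ptens_ract.
Qed.
End Linear.

Section Hom.
Context (f : dgHom M M').

Let flin := dgh_rlinear f.

Lemma tmapl_homog i t : homog (@dgm_comp R D (tensor M L)) i t ->
  homog (@dgm_comp R D (tensor M' L)) i (tmapl f t).
Proof.
rewrite -[X in _ -> homog _ X _]addr0; move: i t.
apply: (tensor_homog_ind (dgm_graded (tensor M' L)) (tmapl_rlinear flin).1).
move=> p q m l hm hl; rewrite addr0 (tmapl_pure flin).
by apply: ptens_homog => //; apply: dgh_homog.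
Qed.

Lemma tmapl_diff t : tmapl f (dgm_diff t) = dgm_diff (tmapl f t).
Proof.
have [lD _] := tmapl_rlinear flin.
move: t; apply: tensor_hind.
- by rewrite !(morphD0 (@dgm_diffD R D _)) (morphD0 lD) (morphD0 (@dgm_diffD R D _)).
- by move=> x y hx hy; rewrite lD !dgm_diffD lD hx hy.
move=> p q m l hm hl; rewrite (ptens_diff _ hm) lD (morphDMz lD).
by rewrite !(tmapl_pure flin) (ptens_diff _ (dgh_homog f hm)) dgh_diff.
Qed.

Definition tmaplH : dgHom (tensor M L) (tensor M' L) :=
  DGHom (tmapl_rlinear flin).1 (tmapl_rlinear flin).2 tmapl_homog tmapl_diff.
End Hom.
End MapL.

(* M ⊗ h *)
Section MapR.
Context (M : dgMod C) (L L' : dgBimod C D).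

Definition tmapr (h : L -> L') : tensor M L -> tensor M L' :=
  tensor_lift (fun m l => ptens m (h l)).

Section Linear.
Context (h : L -> L') (hlin : llinear h).
Local Notation b := (fun m l => ptens m (h l) : tensor M L').

Let bDl l : {morph b^~ l : x y / x + y}.
Proof. exact: ptensDl. Qed.
Let bDr m : {morph b m : x y / x + y}.
Proof. by move=> x y; rewrite hlin.1 ptensDr. Qed.
Let bbal m c l : b (ract m c) l = b m (lact c l).
Proof. by rewrite /= hlin.2 ptens_bal. Qed.

Lemma tmapr_pure m l : tmapr h (ptens m l) = ptens m (h l).
Proof. exact: (tensor_liftE bDl bDr bbal). Qed.

Lemma tmaprD : {morph tmapr h : x y / x + y}.
Proof. exact: (tensor_liftD bDl bDr bbal). Qed.
End Linear.

Section Hom.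
Context (f : dgbHom L L').

Let flin := dgbh_llinear f.

Lemma tmapr_ract t d : tmapr f (ract t d) = ract (tmapr f t) d.
Proof.
have lD := tmaprD flin.
apply: (tensor_eq (f := fun t => tmapr f (ract t d))
                  (g := fun t => ract (tmapr f t) d)).
- by move=> x y; rewrite (ractDl d) lD.
- by move=> x y; rewrite lD (ractDl d).
by move=> m l; rewrite ptens_ract !(tmapr_pure flin) ptens_ract dgh_ract.
Qed.

Lemma tmapr_homog i t : homog (@dgm_comp R D (tensor M L)) i t ->
  homog (@dgm_comp R D (tensor M L')) i (tmapr f t).
Proof.
rewrite -[X in _ -> homog _ X _]addr0; move: i t.
apply: (tensor_homog_ind (dgm_graded (tensor M L')) (tmaprD flin)).
move=> p q m l hm hl; rewrite addr0 (tmapr_pure flin).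
by apply: ptens_homog => //; apply: dgh_homog.
Qed.

Lemma tmapr_diff t : tmapr f (dgm_diff t) = dgm_diff (tmapr f t).
Proof.
have lD := tmaprD flin.
move: t; apply: tensor_hind.
- by rewrite !(morphD0 (@dgm_diffD R D _)) (morphD0 lD) (morphD0 (@dgm_diffD R D _)).
- by move=> x y hx hy; rewrite lD !dgm_diffD lD hx hy.
move=> p q m l hm hl; rewrite (ptens_diff _ hm) lD (morphDMz lD).
by rewrite !(tmapr_pure flin) (ptens_diff _ hm) dgh_diff.
Qed.

Definition tmaprH : dgHom (tensor M L) (tensor M L') :=
  DGHom (tmaprD flin) tmapr_ract tmapr_homog tmapr_diff.
End Hom.
End MapR.

End TensorMap.

Section Kernel.
Context (R : comPzRingType) (C D : dgAlg R) (M N : dgBimod C D) (f : dgbHom M N).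

Definition ker_pred : {pred M} := fun x => f x == 0.

Lemma ker_predP x : reflect (f x = 0) (x \in ker_pred).
Proof. exact: eqP. Qed.

Lemma ker_zmod_closed : zmod_closed ker_pred.
Proof.
split; first by apply/ker_predP/(morphD0 (dghD f)).
move=> x y /ker_predP hx /ker_predP hy; apply/ker_predP.
by rewrite (dghD f) (morphDN (dghD f)) hx hy subr0.
Qed.

HB.instance Definition _ := GRing.isZmodClosed.Build M ker_pred ker_zmod_closed.

Record kerT : Type := KerT { kval :> M; _ : kval \in ker_pred }.
HB.instance Definition _ := [isSub for kval].
HB.instance Definition _ := [Choice of kerT by <:].
HB.instance Definition _ := [SubChoice_isSubZmodule of kerT by <:].

Lemma kvalP (x : kerT) : f (kval x) = 0.
Proof. by case: x => x /= /ker_predP. Qed.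

Lemma kvalD : {morph kval : x y / x + y}.
Proof. by []. Qed.

Lemma kval_inj : injective kval.
Proof. exact: val_inj. Qed.

Definition mkKer (x : M) (fx : f x = 0) : kerT :=
  @KerT x (introT (ker_predP x) fx).

Lemma ker_comp_proof i (x : kerT) : f (dgm_comp i (kval x)) = 0.
Proof. by rewrite dgh_comp kvalP (comp0 (dgm_graded N)). Qed.
Lemma ker_diff_proof (x : kerT) : f (dgm_diff (kval x)) = 0.
Proof. by rewrite dgh_diff kvalP (morphD0 (@dgm_diffD _ _ _)). Qed.
Lemma ker_ract_proof (x : kerT) d : f (ract (kval x) d) = 0.
Proof. by rewrite dgh_ract kvalP (morphD0 (ractDl d)). Qed.
Lemma ker_lact_proof c (x : kerT) : f (lact c (kval x)) = 0.
Proof. by rewrite dgbh_lact kvalP (morphD0 (lactDr c)). Qed.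

Definition ker_comp i (x : kerT) : kerT := mkKer (ker_comp_proof i x).
Definition ker_diff (x : kerT) : kerT := mkKer (ker_diff_proof x).
Definition ker_ract (x : kerT) (d : D) : kerT := mkKer (ker_ract_proof x d).
Definition ker_lact (c : C) (x : kerT) : kerT := mkKer (ker_lact_proof c x).

Lemma ker_graded : isGraded ker_comp.
Proof.
have cD i : {morph ker_comp i : x y / x + y}.
  by move=> x y; apply: kval_inj; rewrite /= (compD (dgm_graded M)).
split=> // [i j x|x].
  apply: kval_inj; rewrite /= (comp_comp (dgm_graded M)).
  by case: eqP.
have [s us hs] := comp_fin (dgm_graded M) (kval x); exists s => //.
by apply: kval_inj; rewrite (morphD_sum kvalD).
Qed.

Lemma ker_homogE i (x : kerT) :
  homog ker_comp i x <-> homog (@dgm_comp R D M) i (kval x).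
Proof. by split=> [/(congr1 kval)|h]; last exact: kval_inj. Qed.

Lemma ker_ractDl d : {morph ker_ract^~ d : x y / x + y}.
Proof. by move=> x y; apply: kval_inj; rewrite /= (ractDl d). Qed.
Lemma ker_ractDr x : {morph ker_ract x : c d / c + d}.
Proof. by move=> c d; apply: kval_inj; rewrite /= (ractDr (kval x)). Qed.
Lemma ker_ractA x c d : ker_ract (ker_ract x c) d = ker_ract x (c * d).
Proof. by apply: kval_inj; rewrite /= ractA. Qed.
Lemma ker_ract1 x : ker_ract x 1 = x.
Proof. by apply: kval_inj; rewrite /= ract1. Qed.
Lemma ker_ract_homog i j x d : homog ker_comp i x -> homog (@dga_comp R D) j d ->
  homog ker_comp (i + j) (ker_ract x d).
Proof. by move=> /ker_homogE hx hd; apply/ker_homogE/ract_homog. Qed.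
Lemma ker_diffD : {morph ker_diff : x y / x + y}.
Proof. by move=> x y; apply: kval_inj; rewrite /= dgm_diffD. Qed.
Lemma ker_diff_homog i x : homog ker_comp i x -> homog ker_comp (i - 1) (ker_diff x).
Proof. by move=> /ker_homogE hx; apply/ker_homogE/dgm_diff_homog. Qed.
Lemma ker_diff_diff x : ker_diff (ker_diff x) = 0.
Proof. by apply: kval_inj; rewrite /= dgm_diff_diff. Qed.
Lemma ker_leibniz i x d : homog ker_comp i x ->
  ker_diff (ker_ract x d) =
    ker_ract (ker_diff x) d + ker_ract x (dga_diff d) *~ (-1) ^ i.
Proof.
move=> /ker_homogE hx; apply: kval_inj.
by rewrite kvalD (morphDMz kvalD) /= (dgm_leibniz _ hx).
Qed.

Definition kerMod : dgMod D :=
  @DGMod R D kerT ker_ract ker_comp ker_diff ker_ractDl ker_ractDr ker_ractA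
    ker_ract1 ker_graded ker_ract_homog ker_diffD ker_diff_homog ker_diff_diff
    ker_leibniz.

Lemma ker_lactDl (x : kerMod) : {morph ker_lact^~ x : c d / c + d}.
Proof. by move=> c d; apply: kval_inj; rewrite /= (lactDl (kval x)). Qed.
Lemma ker_lactDr c : {morph (ker_lact c : kerMod -> kerMod) : x y / x + y}.
Proof. by move=> x y; apply: kval_inj; rewrite /= (lactDr c). Qed.
Lemma ker_lactA c d (x : kerMod) : ker_lact c (ker_lact d x) = ker_lact (c * d) x.
Proof. by apply: kval_inj; rewrite /= lactA. Qed.
Lemma ker_lact1 (x : kerMod) : ker_lact 1 x = x.
Proof. by apply: kval_inj; rewrite /= lact1. Qed.
Lemma ker_lact_ract c (x : kerMod) d :
  ker_lact c (ract x d) = ract (ker_lact c x : kerMod) d.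
Proof. by apply: kval_inj; rewrite /= lact_ract. Qed.
Lemma ker_lact_homog i j c (x : kerMod) : homog (@dga_comp R C) i c ->
  homog (@dgm_comp R D kerMod) j x ->
  homog (@dgm_comp R D kerMod) (i + j) (ker_lact c x).
Proof. by move=> hc /ker_homogE hx; apply/ker_homogE/lact_homog. Qed.
Lemma ker_lact_leibniz i c (x : kerMod) : homog (@dga_comp R C) i c ->
  dgm_diff (ker_lact c x : kerMod) =
    (ker_lact (dga_diff c) x : kerMod) + ker_lact c (dgm_diff x) *~ (-1) ^ i.
Proof.
move=> hc; apply: kval_inj.
by rewrite kvalD (morphDMz kvalD) /= (lact_leibniz _ hc).
Qed.

Definition kerBimod : dgBimod C D :=
  @DGBimod R C D kerMod ker_lact ker_lactDl ker_lactDr ker_lactA ker_lact1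
    ker_lact_ract ker_lact_homog ker_lact_leibniz.

Definition ker_incl : dgbHom kerBimod M.
Proof.
exists (@DGHom R D kerBimod M kval kvalD (fun _ _ => erefl)
  (fun i x => (ker_homogE i x).1) (fun _ => erefl)) => //.
Defined.

Section Corestriction.
Context (L : dgBimod C D) (g : dgbHom L M) (fg : forall x, f (g x) = 0).

Definition ker_lift (x : L) : kerT := mkKer (fg x).

Lemma ker_liftD : {morph (ker_lift : L -> kerBimod) : x y / x + y}.
Proof. by move=> x y; apply: kval_inj; rewrite /= (dghD g). Qed.
Lemma ker_lift_ract x d : ker_lift (ract x d) = ract (ker_lift x : kerBimod) d.
Proof. by apply: kval_inj; rewrite /= (dgh_ract g). Qed.
Lemma ker_lift_homog i x : homog (@dgm_comp R D L) i x ->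
  homog (@dgm_comp R D kerBimod) i (ker_lift x).
Proof. by move=> hx; apply/ker_homogE/dgh_homog. Qed.
Lemma ker_lift_diff x : ker_lift (dgm_diff x) = dgm_diff (ker_lift x : kerBimod).
Proof. by apply: kval_inj; rewrite /= (dgh_diff g). Qed.
Lemma ker_lift_lact c x : ker_lift (lact c x) = lact c (ker_lift x : kerBimod).
Proof. by apply: kval_inj; rewrite /= (dgbh_lact g). Qed.

Definition ker_liftH : dgbHom L kerBimod :=
  @DGBHom R C D L kerBimod
    (@DGHom R D L kerBimod ker_lift ker_liftD ker_lift_ract ker_lift_homog
      ker_lift_diff) ker_lift_lact.
End Corestriction.

End Kernel.

Section Bar.
Context (R : comPzRingType) (A B : dgAlg R) (phi : dgAlgHom A B).

(* N|_A ⊗_A B *)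
Definition indMod (N : dgMod B) : dgMod B := tensor (resMod phi N) (phiBimod phi).

Definition ind_pure (N : dgMod B) (x : N) (b : B) : indMod N :=
  @ptens R A B (resMod phi N) (phiBimod phi) x b.

(* h ⊗_A B *)
Definition ind_map (N N' : dgMod B) (h : N -> N') : indMod N -> indMod N' :=
  @tmapl R A B (resMod phi N) (resMod phi N') (phiBimod phi) h.

Section IndPure.
Context (N : dgMod B).

Lemma ind_pureDl (b : B) : {morph (fun x : N => ind_pure x b) : x y / x + y}.
Proof. exact: (@ptensDl R A B (resMod phi N) (phiBimod phi)). Qed.

Lemma ind_pureDr (x : N) : {morph (fun b : B => ind_pure x b) : b c / b + c}.
Proof. exact: (@ptensDr R A B (resMod phi N) (phiBimod phi)). Qed.

Lemma ind_pure_bal (x : N) a b : ind_pure (ract x (phi a)) b = ind_pure x (phi a * b).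
Proof. exact: (@ptens_bal R A B (resMod phi N) (phiBimod phi)). Qed.

Lemma ind_pure_ract (x : N) b c : ract (ind_pure x b) c = ind_pure x (b * c).
Proof. exact: (@ptens_ract R A B (resMod phi N) (phiBimod phi)). Qed.

Lemma ind_eq (W : zmodType) (f g : indMod N -> W) :
  {morph f : x y / x + y} -> {morph g : x y / x + y} ->
  (forall m l, f (ind_pure m l) = g (ind_pure m l)) -> f =1 g.
Proof. exact: (@tensor_eq R A B (resMod phi N) (phiBimod phi)). Qed.

End IndPure.

Section IndMap.
Context (N N' : dgMod B) (h : N -> N') (hlin : rlinear h).

Lemma res_rlinear : @rlinear R A (resMod phi N) (resMod phi N') h.
Proof. by split=> [|x a] /=; [apply: hlin.1 | apply: hlin.2]. Qed.

Lemma ind_map_pure x b : ind_map h (ind_pure x b) = ind_pure (h x) b.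
Proof. exact: (tmapl_pure res_rlinear). Qed.

Lemma ind_map_rlinear : rlinear (ind_map h).
Proof. exact: (tmapl_rlinear _ res_rlinear). Qed.
End IndMap.

Definition res_hom (N N' : dgMod B) (f : dgHom N N') :
    dgHom (resMod phi N) (resMod phi N') :=
  @DGHom R A (resMod phi N) (resMod phi N') f (dghD f)
    (fun x a => dgh_ract f x (phi a)) (@dgh_homog R B N N' f) (dgh_diff f).

Definition ind_hom (N N' : dgMod B) (f : dgHom N N') : dgHom (indMod N) (indMod N') :=
  tmaplH (phiBimod phi) (res_hom f).

(* pi_N : N|_A ⊗_A B -> N, x ⊗ b |-> x b *)
Section Pi.
Context (N : dgMod B).
Local Notation b := (fun (x : resMod phi N) (c : phiBimod phi) => @ract R B N x c).

Let bDl c : {morph b^~ c : x y / x + y}. Proof. exact: (@ractDl R B N). Qed.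
Let bDr x : {morph b x : x y / x + y}. Proof. exact: (@ractDr R B N). Qed.
Let bbal (m : resMod phi N) a (l : phiBimod phi) : b (ract m a) l = b m (lact a l).
Proof. exact: ractA. Qed.
Let bract m (l : phiBimod phi) d : b m (ract l d) = ract (b m l) d.
Proof. by rewrite /= ractA. Qed.
Let bhomog p q m l : homog (@dgm_comp R A (resMod phi N)) p m ->
  homog (@dgm_comp R B (phiBimod phi)) q l ->
  homog (@dgm_comp R B N) (p + q) (b m l).
Proof. exact: (@ract_homog R B N p q m l). Qed.
Let bdiff p m (l : phiBimod phi) : homog (@dgm_comp R A (resMod phi N)) p m ->
  b (dgm_diff m) l + b m (dgm_diff l) *~ (-1) ^ p = dgm_diff (b m l).
Proof. by move=> hm; apply/esym/(@dgm_leibniz R B N p m l hm). Qed.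

Definition piN : dgHom (indMod N) N := tensor_liftH bDl bDr bbal bract bhomog bdiff.

Lemma piN_pure (x : N) c : piN (ind_pure x c) = ract x c.
Proof. exact: (tensor_liftE bDl bDr bbal). Qed.
End Pi.

Definition naively_liftable (N : dgMod B) : Prop := split_epi (piN N).

(* barT N n is N ⊗_A B ⊗_A ... ⊗_A B with n factors B.  Thus barT N n.+1 is
   N ⊗_A B^{⊗ n} ⊗_A B and barT (regMod B) n is B^{⊗ (n + 1)}. *)
Fixpoint barT (N : dgMod B) (n : nat) : dgMod B :=
  if n is n'.+1 then indMod (barT N n') else N.

(* bar_face N n i multiplies the i-th and the (i+1)-st factor, N having
   index 0: x ⊗ b_1 ⊗ ... ⊗ b_(n+1) is mapped to
     x b_1 ⊗ b_2 ⊗ ... ⊗ b_(n+1)                       if i = 0,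
     x ⊗ b_1 ⊗ ... ⊗ b_i b_(i+1) ⊗ ... ⊗ b_(n+1)       if 0 < i <= n. *)
Fixpoint bar_face (N : dgMod B) (n i : nat) {struct n} :
    dgHom (barT N n.+1) (barT N n) :=
  match n return dgHom (barT N n.+1) (barT N n) with
  | 0 => piN N
  | n'.+1 => if i == n'.+1 then piN (barT N n'.+1) else ind_hom (bar_face N n' i)
  end.

Section BarDiff.
Context (N : dgMod B) (n : nat).

Definition bar_d_fun (t : barT N n.+1) : barT N n :=
  \sum_(i < n.+1) bar_face N n i t *~ (-1) ^+ i.

Lemma bar_dD : {morph bar_d_fun : x y / x + y}.
Proof.
move=> x y; rewrite /bar_d_fun -big_split; apply: eq_bigr => i _.
by rewrite dghD mulrzDl.
Qed.

Lemma bar_d_ract x c : bar_d_fun (ract x c) = ract (bar_d_fun x) c.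
Proof.
rewrite /bar_d_fun (morphD_sum (ractDl c)); apply: eq_bigr => i _.
by rewrite dgh_ract (morphDMz (ractDl c)).
Qed.

Lemma bar_d_homog i x : homog (@dgm_comp R B (barT N n.+1)) i x ->
  homog (@dgm_comp R B (barT N n)) i (bar_d_fun x).
Proof.
move=> hx; have gr := dgm_graded (barT N n); rewrite /bar_d_fun.
apply: (big_ind (homog (@dgm_comp R B (barT N n)) i)).
- exact: homog0.
- by move=> y z; apply: homogD.
- by move=> j _; apply: homogMz => //; apply: dgh_homog.
Qed.

Lemma bar_d_diff x : bar_d_fun (dgm_diff x) = dgm_diff (bar_d_fun x).
Proof.
rewrite /bar_d_fun (morphD_sum (@dgm_diffD R B _)); apply: eq_bigr => i _.
by rewrite dgh_diff (morphDMz (@dgm_diffD R B _)).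
Qed.

(* The map d^N_(n-1) : N ⊗_A B^{⊗ n} ⊗_A B -> N ⊗_A B^{⊗ (n-1)} ⊗_A B, the
   alternating sum of the faces; for n = 0 it is d^N_(-1) : N ⊗_A B -> N.
   For N = B these are the maps of the bar resolution. *)
Definition bar_d : dgHom (barT N n.+1) (barT N n) :=
  DGHom bar_dD bar_d_ract bar_d_homog bar_d_diff.

End BarDiff.

Lemma bar_d0_pure (N : dgMod B) (x : N) b :
  bar_d N 0 (ind_pure x b : barT N 1) = ract x b.
Proof. by rewrite /= /bar_d_fun big_ord1 expr0 mulr1z; apply: piN_pure. Qed.

Lemma bar_dS_pure (N : dgMod B) n (u : barT N n.+1) b :
  bar_d N n.+1 (ind_pure u b : barT N n.+2) =
  (ind_pure (bar_d N n u) b : barT N n.+1) + ract u b *~ (-1) ^+ n.+1.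
Proof.
rewrite /= /bar_d_fun big_ord_recr; congr (_ + _); last first.
  by rewrite [bar_face _ _ _]/= eqxx piN_pure.
rewrite (morphD_sum (@ind_pureDl (barT N n) b)); apply: eq_bigr => i _.
rewrite (morphDMz (@ind_pureDl (barT N n) b)); congr (_ *~ _).
rewrite [bar_face _ _ _]/= (ltn_eqF (ltn_ord i)).
exact: (ind_map_pure (dgh_rlinear (bar_face N n i))).
Qed.

Lemma bar_d_d (N : dgMod B) n (t : barT N n.+2) : bar_d N n (bar_d N n.+1 t) = 0.
Proof.
elim: n t => [|n IH] t.
  apply: (ind_eq (f := fun t => bar_d N 0 (bar_d N 1 t)) (g := fun=> 0)) => //.
  - by move=> x y; rewrite !dghD.
  - by move=> x y; rewrite addr0.
  move=> u b; rewrite bar_dS_pure dghD bar_d0_pure (morphDMz (dghD _)).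
  by rewrite dgh_ract expr1 mulrN1z subrr.
apply: (ind_eq (f := fun t => bar_d N n.+1 (bar_d N n.+2 t)) (g := fun=> 0)) => //.
- by move=> x y; rewrite !dghD.
- by move=> x y; rewrite addr0.
move=> u b; rewrite bar_dS_pure dghD bar_dS_pure (morphDMz (dghD _)) dgh_ract IH.
rewrite (morphD0 (@ind_pureDl (barT N n) b)) add0r [in X in _ + X]exprS.
by rewrite mulN1r mulrNz subrr.
Qed.

(* h ⊗ id ⊗ ... ⊗ id *)
Fixpoint bar_map (N N' : dgMod B) (h : N -> N') (n : nat) : barT N n -> barT N' n :=
  match n return barT N n -> barT N' n with
  | 0 => h
  | n'.+1 => ind_map (@bar_map N N' h n')
  end.
Arguments bar_map {N N'} h n _.

Lemma bar_map_rlinear (N N' : dgMod B) (h : N -> N') n :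
  rlinear h -> rlinear (bar_map h n).
Proof. by move=> hlin; elim: n => //= n IH; apply: ind_map_rlinear. Qed.

Lemma bar_map_pure (N N' : dgMod B) (h : N -> N') n (u : barT N n) b :
  rlinear h -> bar_map h n.+1 (ind_pure u b) = ind_pure (bar_map h n u) b.
Proof. by move=> hlin; apply: ind_map_pure; apply: bar_map_rlinear. Qed.

Lemma bar_map_d (N N' : dgMod B) (h : N -> N') n t : rlinear h ->
  bar_d N' n (bar_map h n.+1 t) = bar_map h n (bar_d N n t).
Proof.
move=> hlin; have hD m := (@bar_map_rlinear N N' h m hlin).1.
elim: n t => [|n IH] t.
  apply: (ind_eq (f := fun t => bar_d N' 0 (bar_map h 1 t))
                 (g := fun t => bar_map h 0 (bar_d N 0 t))).
  - by move=> x y; rewrite (hD 1%N) dghD.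
  - by move=> x y; rewrite dghD (hD 0%N).
  by move=> u b; rewrite (bar_map_pure _ _ hlin) !bar_d0_pure; apply/esym/hlin.2.
apply: (ind_eq (f := fun t => bar_d N' n.+1 (bar_map h n.+2 t))
               (g := fun t => bar_map h n.+1 (bar_d N n.+1 t))).
- by move=> x y; rewrite (hD n.+2) dghD.
- by move=> x y; rewrite dghD (hD n.+1).
move=> u b; rewrite (bar_map_pure _ _ hlin) !bar_dS_pure IH.
rewrite (hD n.+1) (bar_map_pure _ _ hlin) (morphDMz (hD n.+1)).
by rewrite (@bar_map_rlinear N N' h n.+1 hlin).2.
Qed.

(* x (b_0 ⊗ b_1 ⊗ ... ⊗ b_n) = x b_0 ⊗ b_1 ⊗ ... ⊗ b_n *)
Definition bar_act (N : dgMod B) (x : N) (n : nat) : barT (regMod B) n -> barT N n :=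
  bar_map (fun b : regMod B => ract x b) n.
Arguments bar_act {N} x n _.

Lemma act_rlinear (N : dgMod B) (x : N) : rlinear (fun b : regMod B => ract x b).
Proof. by split=> [|b c] /=; [apply: ractDr | rewrite ractA]. Qed.

Section BarAct.
Context (N : dgMod B).

Lemma bar_act_pure (x : N) n u b :
  bar_act x n.+1 (ind_pure u b) = ind_pure (bar_act x n u) b.
Proof. exact: (bar_map_pure _ _ (act_rlinear x)). Qed.

Lemma bar_actDr (x : N) n : {morph bar_act x n : s t / s + t}.
Proof. exact: (bar_map_rlinear _ (act_rlinear x)).1. Qed.

Lemma bar_act_ract (x : N) n t c : bar_act x n (ract t c) = ract (bar_act x n t) c.
Proof. exact: (bar_map_rlinear _ (act_rlinear x)).2. Qed.

Lemma bar_actDl n t : {morph (fun x : N => bar_act x n t) : x y / x + y}.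
Proof.
move=> x y; elim: n t => [|n IH] t; first exact: ractDl.
apply: (ind_eq (f := bar_act (x + y) n.+1)
               (g := fun t => bar_act x n.+1 t + bar_act y n.+1 t)).
- exact: (@bar_actDr (x + y) n.+1).
- by move=> s t'; rewrite !(@bar_actDr _ n.+1) addrACA.
by move=> u b; rewrite !bar_act_pure IH (@ind_pureDl (barT N n) b).
Qed.

End BarAct.

Section BarActDG.
Context (N : dgMod B).

Lemma bar_actA (x : N) b n t :
  bar_act x n (bar_act (b : regMod B) n t) = bar_act (ract x b) n t.
Proof.
elim: n t => [|n IH] t; first exact: esym (ractA _ _ _).
apply: (ind_eq (f := fun t => bar_act x n.+1 (bar_act (b : regMod B) n.+1 t))
               (g := bar_act (ract x b) n.+1)).
- by move=> s t'; rewrite (@bar_actDr (regMod B) b n.+1) (@bar_actDr N x n.+1).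
- exact: (@bar_actDr N (ract x b) n.+1).
by move=> u c; rewrite !bar_act_pure IH.
Qed.

Lemma bar_act_homog n i j (x : N) t : homog (@dgm_comp R B N) i x ->
  homog (@dgm_comp R B (barT (regMod B) n)) j t ->
  homog (@dgm_comp R B (barT N n)) (i + j) (bar_act x n t).
Proof.
move=> hx; rewrite addrC; elim: n j t => [|n IH] j t.
  by rewrite addrC => ht; apply: ract_homog.
move: j t; apply: (@tensor_homog_ind R A B (resMod phi (barT (regMod B) n))
  (phiBimod phi) _ _ _ _ (dgm_graded (barT N n.+1)) (@bar_actDr N x n.+1)).
move=> p q u b hu hb; rewrite bar_act_pure addrAC.
apply: (@ptens_homog R A B (resMod phi (barT N n)) (phiBimod phi)) => //.
exact: IH.
Qed.

Lemma bar_act_diff n i (x : N) t : homog (@dgm_comp R B N) i x ->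
  dgm_diff (bar_act x n t) =
    bar_act (dgm_diff x) n t + bar_act x n (dgm_diff t) *~ (-1) ^ i.
Proof.
move=> hx; elim: n t => [|n IH] t; first exact: dgm_leibniz.
have dD m := @dgm_diffD R B (barT N m).
have dD' m := @dgm_diffD R B (barT (regMod B) m).
move: t; apply: (@tensor_hind R A B (resMod phi (barT (regMod B) n)) (phiBimod phi)).
- rewrite (morphD0 (dD' n.+1)) !(morphD0 (@bar_actDr N _ n.+1)) (morphD0 (dD n.+1)).
  by rewrite mul0rz addr0.
- move=> s t hs ht; rewrite (@bar_actDr N x n.+1) (dD n.+1) hs ht (dD' n.+1) !(@bar_actDr N _ n.+1).
  by rewrite mulrzDl addrACA.
move=> p q u b hu hb; rewrite bar_act_pure.
rewrite (@ptens_diff R A B (resMod phi (barT N n)) (phiBimod phi) (i + p) _ _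
  (bar_act_homog hx hu)).
rewrite (@ptens_diff R A B (resMod phi (barT (regMod B) n)) (phiBimod phi) p _ _ hu).
rewrite (@bar_actDr N x n.+1) (morphDMz (@bar_actDr N x n.+1)) !bar_act_pure.
rewrite [dgm_diff (bar_act x n u)]IH.
rewrite [ptens _ b](@ind_pureDl (barT N n) b) (morphDMz (@ind_pureDl (barT N n) b)).
by rewrite mulrzDl -mulrzA [(-1) ^ p * _]mulrC -N1_exprzD addrA.
Qed.

End BarActDG.

Lemma bar_act1 n (t : barT (regMod B) n) : bar_act (1 : regMod B) n t = t.
Proof.
elim: n t => [|n IH] t; first exact: mul1r.
apply: (ind_eq (f := bar_act (1 : regMod B) n.+1) (g := id)) => //.
  exact: (@bar_actDr (regMod B) 1 n.+1).
by move=> u b; rewrite bar_act_pure IH.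
Qed.

(* B^{⊗ (n + 1)} as a DG (B, B)-bimodule: left multiplication on the first and
   right multiplication on the last factor.  Passing between left and right
   actions, b t = (-1)^(|b||t|) t (b ⊗ 1), this is the DG B^e-module structure. *)
Definition barBimod (n : nat) : dgBimod B B :=
  @DGBimod R B B (barT (regMod B) n) (fun b t => bar_act (b : regMod B) n t)
    (@bar_actDl (regMod B) n) (fun b => @bar_actDr (regMod B) b n)
    (fun b c t => @bar_actA (regMod B) b c n t)
    (@bar_act1 n) (fun b t c => @bar_act_ract (regMod B) b n t c)
    (fun i j b t => @bar_act_homog (regMod B) n i j b t)
    (fun i b t => @bar_act_diff (regMod B) n i b t).

(* The two A-actions agree up to the Koszul sign, as required of B^e-modules. *)
Lemma barBimod_central n i j (a : A) (t : barBimod n) :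
  homog (@dga_comp R A) i a -> homog (@dgm_comp R B (barBimod n)) j t ->
  lact (phi a) t = ract t (phi a) *~ (-1) ^ (i * j).
Proof.
move=> ha; elim: n j t => [|n IH] j t.
  by move=> ht; apply: dga_comm ht; apply: dgah_homog.
move=> <-; have cD := compD (dgm_graded (barT (regMod B) n.+1)) j.
have lD := @lactDr R B B (barBimod n.+1) (phi a).
have rD := @ractDl R B (barBimod n.+1) (phi a).
move: t; apply: (@tensor_hind R A B (resMod phi (barT (regMod B) n)) (phiBimod phi)).
- by rewrite (morphD0 cD) (morphD0 lD) (morphD0 rD) mul0rz.
- by move=> s t hs ht; rewrite cD lD rD hs ht mulrzDl.
move=> p q u b hu hb; rewrite (homog_compE (dgm_graded (barT (regMod B) n.+1)) j
  (@ptens_homog R A B (resMod phi (barT (regMod B) n)) (phiBimod phi) _ _ _ _ hu hb)).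
case: (j =P p + q) => [->|_]; last by rewrite (morphD0 lD) (morphD0 rD) mul0rz.
have pD := @ind_pureDl (barT (regMod B) n) b.
have pD' := @ind_pureDr (barT (regMod B) n) u.
transitivity (ind_pure (lact (phi a) (u : barBimod n) : barT (regMod B) n) b).
  exact: (@bar_act_pure (regMod B)).
rewrite (IH _ _ hu) (morphDMz pD) ind_pure_bal.
rewrite (dga_comm (dgah_homog phi ha) hb) (morphDMz pD') -mulrzA mulrC.
rewrite -N1_exprzD -mulrDr; congr (_ *~ _).
exact/esym/(@ind_pure_ract (barT (regMod B) n)).
Qed.

(* The map d_(n-1) of the bar resolution, as a map of bimodules *)
Definition bar_dB (n : nat) : dgbHom (barBimod n.+1) (barBimod n) :=
  @DGBHom R B B (barBimod n.+1) (barBimod n) (bar_d (regMod B) n)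
    (fun b t => bar_map_d t (act_rlinear (b : regMod B))).

(* J n is ^n J: B for n = 0, and the kernel of d_(n-2) for n >= 1. *)
Definition J (n : nat) : dgBimod B B :=
  if n is n'.+1 then kerBimod (bar_dB n') else barBimod 0.

Definition J_incl (n : nat) : dgbHom (J n.+1) (barBimod n.+1) :=
  ker_incl (bar_dB n).

(* d_(n-1) with codomain restricted to ^n J *)
Definition bar_dJ (n : nat) : dgbHom (barBimod n.+1) (J n) :=
  match n return dgbHom (barBimod n.+1) (J n) with
  | 0 => bar_dB 0
  | n'.+1 => @ker_liftH R B B _ _ (bar_dB n') _ (bar_dB n'.+1)
               (@bar_d_d (regMod B) n')
  end.

Section Identification.
Context (N : dgMod B).

Section Fwd.
Context (n : nat).
Local Notation b := (fun (x : N) (t : barBimod n) => bar_act x n t).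

Let bDl t : {morph b^~ t : x y / x + y}. Proof. exact: bar_actDl. Qed.
Let bDr x : {morph b x : x y / x + y}. Proof. exact: bar_actDr. Qed.
Let bbal m c l : b (ract m c) l = b m (lact c l).
Proof. by rewrite /= bar_actA. Qed.
Let bract m l d : b m (ract l d) = ract (b m l) d.
Proof. exact: bar_act_ract. Qed.
Let bhomog p q m l : homog (@dgm_comp R B N) p m ->
  homog (@dgm_comp R B (barBimod n)) q l ->
  homog (@dgm_comp R B (barT N n)) (p + q) (b m l).
Proof. exact: bar_act_homog. Qed.
Let bdiff p m l : homog (@dgm_comp R B N) p m ->
  b (dgm_diff m) l + b m (dgm_diff l) *~ (-1) ^ p = dgm_diff (b m l).
Proof. by move=> hm; rewrite (bar_act_diff _ hm). Qed.

(* x ⊗ (b_0 ⊗ b_1 ⊗ ... ⊗ b_n) |-> x b_0 ⊗ b_1 ⊗ ... ⊗ b_n *)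
Definition ident : dgHom (tensor N (barBimod n)) (barT N n) :=
  tensor_liftH bDl bDr bbal bract bhomog bdiff.

Lemma ident_pure x (t : barBimod n) : ident (ptens x t) = bar_act x n t.
Proof. exact: (tensor_liftE bDl bDr bbal). Qed.
End Fwd.

(* t |-> t ⊗ b, for b in B *)
Definition bar_app (n : nat) (b : B) (t : barBimod n) : barBimod n.+1 :=
  ind_pure t b.

Lemma bar_app_llinear n b : llinear (@bar_app n b).
Proof.
split; first exact: (@ind_pureDl (barT (regMod B) n) b).
by move=> c t; rewrite /= /bar_app bar_act_pure.
Qed.

(* x ⊗ b_1 ⊗ ... ⊗ b_n |-> x ⊗ (1 ⊗ b_1 ⊗ ... ⊗ b_n) *)
Fixpoint ident_inv_fun (n : nat) : barT N n -> tensor N (barBimod n) :=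
  match n return barT N n -> tensor N (barBimod n) with
  | 0 => fun x => @ptens R B B N (barBimod 0) x 1
  | n'.+1 => @tensor_lift R A B (resMod phi (barT N n')) (phiBimod phi) _
      (fun u b => tmapr (bar_app b) (ident_inv_fun u))
  end.

Lemma tmapr_appDr n (w : tensor N (barBimod n)) :
  {morph (fun b : B => tmapr (@bar_app n b) w) : b c / b + c}.
Proof.
move=> b c; apply: (tensor_eq (f := tmapr (@bar_app n (b + c)))
  (g := fun w => tmapr (@bar_app n b) w + tmapr (@bar_app n c) w)).
- exact: (tmaprD (bar_app_llinear _ _)).
- by move=> x y; rewrite !(tmaprD (bar_app_llinear _ _)) addrACA.
move=> x t; rewrite !(tmapr_pure (bar_app_llinear _ _)) -ptensDr.
by rewrite /bar_app ind_pureDr.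
Qed.

Lemma tmapr_app_bal n (w : tensor N (barBimod n)) a b :
  tmapr (@bar_app n b) (ract w (phi a)) = tmapr (@bar_app n (phi a * b)) w.
Proof.
apply: (tensor_eq (f := fun w => tmapr (@bar_app n b) (ract w (phi a)))
  (g := tmapr (@bar_app n (phi a * b)))).
- by move=> x y; rewrite (ractDl (phi a)) (tmaprD (bar_app_llinear _ _)).
- exact: (tmaprD (bar_app_llinear _ _)).
move=> x t; rewrite ptens_ract !(tmapr_pure (bar_app_llinear _ _)).
by rewrite /bar_app ind_pure_bal.
Qed.

Lemma tmapr_app_ract n (w : tensor N (barBimod n)) b c :
  ract (tmapr (@bar_app n b) w) c = tmapr (@bar_app n (b * c)) w.
Proof.
apply: (tensor_eq (f := fun w => ract (tmapr (@bar_app n b) w) c)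
  (g := tmapr (@bar_app n (b * c)))).
- by move=> x y; rewrite (tmaprD (bar_app_llinear _ _)) (ractDl c).
- exact: (tmaprD (bar_app_llinear _ _)).
move=> x t; rewrite !(tmapr_pure (bar_app_llinear _ _)) ptens_ract.
by congr ptens; rewrite /bar_app -ind_pure_ract.
Qed.

Lemma ident_inv_spec n : rlinear (@ident_inv_fun n) /\
  forall u b, @ident_inv_fun n.+1 (ind_pure u b) =
    tmapr (bar_app b) (@ident_inv_fun n u).
Proof.
pose b n := (fun (u : resMod phi (barT N n)) (b : phiBimod phi) =>
  tmapr (@bar_app n b) (@ident_inv_fun n u)).
suff H : rlinear (@ident_inv_fun n).
  split=> // u c; apply: (@tensor_liftE R A B _ (phiBimod phi) _ (b n)).
  - by move=> l x y; rewrite /b H.1 (tmaprD (bar_app_llinear _ _)).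
  - by move=> m; apply: tmapr_appDr.
  - by move=> m a l; rewrite /b [ident_inv_fun _](H.2 m (phi a)) tmapr_app_bal.
elim: n => [|n H].
  split; first exact: ptensDl.
  move=> x c.
  transitivity (@ptens R B B N (barBimod 0) x (c * 1)).
    exact: (@ptens_bal R B B N (barBimod 0) x c 1).
  transitivity (@ptens R B B N (barBimod 0) x (1 * c)); first by rewrite mulr1 mul1r.
  exact: esym (@ptens_ract R B B N (barBimod 0) x 1 c).
have bDl l : {morph (b n)^~ l : x y / x + y}.
  by move=> x y; rewrite /b H.1 (tmaprD (bar_app_llinear _ _)).
have bDr m : {morph (b n) m : x y / x + y}.
  exact: tmapr_appDr.
have bbal m a l : b n (ract m a) l = b n m (lact a l).
  by rewrite /b [ident_inv_fun _](H.2 m (phi a)) tmapr_app_bal.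
split; first exact: (tensor_liftD bDl bDr bbal).
by apply: (tensor_lift_ract bDl bDr bbal) => m l d; rewrite /b tmapr_app_ract.
Qed.

Lemma identK n : cancel (@ident n) (@ident_inv_fun n).
Proof.
have invD m := (ident_inv_spec m).1.1.
have H x m (t : barBimod m) : ident_inv_fun (bar_act x m t) = ptens x t.
  elim: m t => [|m IH] t.
    transitivity (@ptens R B B N (barBimod 0) x ((t : B) * 1)).
      exact: (@ptens_bal R B B N (barBimod 0) x t 1).
    by rewrite mulr1.
  apply: (@ind_eq (barT (regMod B) m) _
     (fun t => @ident_inv_fun m.+1 (bar_act x m.+1 t))
     (fun t => @ptens R B B N (barBimod m.+1) x t)).
  - by move=> s s'; rewrite bar_actDr (invD m.+1).
  - exact: (@ptensDr R B B N (barBimod m.+1) x).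
  move=> u b; rewrite bar_act_pure (ident_inv_spec m).2 IH.
  by rewrite (tmapr_pure (bar_app_llinear _ _)).
move=> w; apply: (tensor_eq (f := fun w => ident_inv_fun (ident n w)) (g := id)) => //.
- by move=> x y; rewrite dghD invD.
- by move=> x t; rewrite ident_pure H.
Qed.

Lemma ident_invK n : cancel (@ident_inv_fun n) (@ident n).
Proof.
have invD m := (ident_inv_spec m).1.1.
elim: n => [|n IH] t.
  exact: etrans (@ident_pure 0 t (1 : regMod B)) (ract1 t).
apply: (@ind_eq (barT N n) (barT N n.+1)
  (fun t => ident n.+1 (@ident_inv_fun n.+1 t)) id) => //.
  by move=> x y; rewrite (invD n.+1) dghD.
move=> u b; rewrite (ident_inv_spec n).2 -[in RHS](IH u).
move: (ident_inv_fun u) => w.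
apply: (tensor_eq (f := fun w => ident n.+1 (tmapr (bar_app b) w))
  (g := fun w => ind_pure (ident n w) b)).
- by move=> x y; rewrite (tmaprD (bar_app_llinear _ _)) dghD.
- by move=> x y; rewrite dghD (@ind_pureDl (barT N n) b).
move=> x s; rewrite (tmapr_pure (bar_app_llinear _ _)) !ident_pure.
by rewrite /bar_app bar_act_pure.
Qed.

Lemma ident_inv_homog n i x : homog (@dgm_comp R B (barT N n)) i x ->
  homog (@dgm_comp R B (tensor N (barBimod n))) i (ident_inv_fun x).
Proof.
move=> hx; apply: (can_inj (@identK n)).
by rewrite dgh_comp ident_invK.
Qed.

Lemma ident_inv_diff n (x : barT N n) :
  ident_inv_fun (dgm_diff x) = dgm_diff (ident_inv_fun x).
Proof. by apply: (can_inj (@identK n)); rewrite dgh_diff !ident_invK. Qed.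

Definition ident_inv n : dgHom (barT N n) (tensor N (barBimod n)) :=
  DGHom (ident_inv_spec n).1.1 (ident_inv_spec n).1.2 (@ident_inv_homog n)
    (@ident_inv_diff n).

(* Under the identification, N ⊗_B d_(n-1) becomes d^N_(n-1). *)
Lemma ident_bar_d n (w : tensor N (barBimod n.+1)) :
  ident n (tmaprH N (bar_dB n) w) = bar_d N n (ident n.+1 w).
Proof.
apply: (tensor_eq (f := fun w => ident n (tmaprH N (bar_dB n) w))
  (g := fun w => bar_d N n (ident n.+1 w))).
- by move=> x y; rewrite !dghD.
- by move=> x y; rewrite !dghD.
move=> x t; rewrite [tmaprH _ _ _](tmapr_pure (dgbh_llinear (bar_dB n))).
by rewrite !ident_pure; apply/esym/(bar_map_d _ (act_rlinear x)).
Qed.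

(* 0 -> N ⊗_B ^(n+1)J -> N ⊗_A B^{⊗ n} ⊗_A B -> N ⊗_B ^n J -> 0 *)
Definition ses_f (n : nat) : dgHom (tensor N (J n.+1)) (barT N n.+1) :=
  dgcomp (ident n.+1) (tmaprH N (J_incl n)).

Definition ses_g (n : nat) : dgHom (barT N n.+1) (tensor N (J n)) :=
  dgcomp (tmaprH N (bar_dJ n)) (ident_inv n.+1).

End Identification.

(* The sequence displayed above is the one indexed by n + 1 >= 1 in the usual
   numbering 0 -> N ⊗_B ^n J -> N ⊗_A B^{⊗ (n - 1)} ⊗_A B -> N ⊗_B ^(n-1)J -> 0,
   so all n >= 1 are covered. *)
Definition bar_split_exact (N : dgMod B) : Prop :=
  forall n : nat, splits (ses_f N n) (ses_g N n).

End Bar.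

(* Main.v *)
Require Import Defs.
From mathcomp Require Import all_boot all_order all_algebra.

Set Implicit Arguments.
Unset Strict Implicit.
Unset Printing Implicit Defensive.

Import GRing.Theory.

Local Open Scope ring_scope.

(** The complex N ⊗_B (B, d) carries two contractions, one for each half of
    split exactness.

    Appending 1 on the right, t |-> ± t ⊗ 1, contracts the bar resolution by
    maps that are left B-linear, though not compatible with the right action
    ([bar_d_append]).  Hence 0 -> ^(n+1)J -> B^{⊗ (n+2)} -> ^n J -> 0 splits
    over the left action, and such a sequence stays exact under M ⊗_B - for
    every M ([tensor_short_exact]).

    A DG section s of π_N : N ⊗_A B -> N, applied to the leftmost factor, gives
    DG B-module maps σ_n = s ⊗ B^{⊗ n} with d σ + σ d = 1
    ([bar_homotopy_contract]).  On N ⊗_B ^n J the term σ d vanishes, so σ_n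
    restricts there to a DG section of the n-th short exact sequence.

    Conversely the sequence for n = 0 is π_N itself, up to the identification
    N ⊗_B B = N. *)

(** * Left-split sequences of bimodules *)

Section TensorSplit.
Context (R : comPzRingType) (C D : dgAlg R).

Lemma tmapr_comp_eq (M : dgMod C) (L L' L'' : dgBimod C D)
    (f : L -> L') (g : L' -> L'') (k : L -> L'') :
  llinear f -> llinear g -> llinear k -> (forall x, g (f x) = k x) ->
  forall w : tensor M L, tmapr g (tmapr f w) = tmapr k w.
Proof.
move=> fl gl kl gf; apply: (tensor_eq (f := fun w => tmapr g (tmapr f w))).
- by move=> x y; rewrite (tmaprD fl) (tmaprD gl).
- exact: tmaprD.
by move=> m l; rewrite (tmapr_pure fl) (tmapr_pure gl) (tmapr_pure kl) gf.
Qed.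

Lemma id_llinear (L : dgBimod C D) : llinear (id : L -> L).
Proof. by []. Qed.

Lemma tmapr_id (M : dgMod C) (L : dgBimod C D) (w : tensor M L) :
  tmapr (id : L -> L) w = w.
Proof.
move: w; apply: (tensor_eq (g := id)) => //.
  exact: (tmaprD (id_llinear L)).
by move=> m l; rewrite (tmapr_pure (id_llinear L)).
Qed.

Lemma tmapr_cancel (M : dgMod C) (L L' : dgBimod C D) (f : L -> L')
    (g : L' -> L) : llinear f -> llinear g -> cancel f g ->
  cancel (tmapr f : tensor M L -> tensor M L') (tmapr g).
Proof.
move=> fl gl gf w; rewrite -[RHS]tmapr_id.
exact: (tmapr_comp_eq fl gl (id_llinear L)).
Qed.

(** The splitting maps are only assumed left linear: this is all that survives
    in M ⊗_C -, and it suffices to transport exactness, as both splittings and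
    the relations between them are preserved. *)
Lemma tensor_short_exact (M : dgMod C) (K L Q : dgBimod C D)
    (i : dgbHom K L) (p : dgbHom L Q) (r : L -> K) (h : Q -> L) :
  llinear r -> llinear h -> cancel i r -> cancel h p ->
  (forall x, p (i x) = 0) -> (forall y, i (r y) + h (p y) = y) ->
  short_exact (tmaprH M i) (tmaprH M p).
Proof.
move=> rl hl ri ph pi irhp.
have il := dgbh_llinear i; have pl := dgbh_llinear p.
have pi0 w : tmaprH M p (tmaprH M i w) = 0.
  move: w; apply: (tensor_eq (g := fun=> 0)).
  - by move=> x y; rewrite !dghD.
  - by move=> x y; rewrite addr0.
  move=> m l; rewrite /= (tmapr_pure il) (tmapr_pure pl) pi.
  exact: (morphD0 (ptensDr m)).
have dec (w : tensor M L) : tmapr i (tmapr r w) + tmapr h (tmapr p w) = w.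
  move: w; apply: (tensor_eq (g := id)
    (f := fun w => tmapr i (tmapr r w) + tmapr h (tmapr p w))) => //.
    move=> x y; rewrite (tmaprD rl) (tmaprD il) (tmaprD pl) (tmaprD hl).
    by rewrite addrACA.
  move=> m l; rewrite (tmapr_pure rl) (tmapr_pure il) (tmapr_pure pl).
  by rewrite (tmapr_pure hl) -ptensDr irhp.
split.
- exact: (can_inj (tmapr_cancel il rl ri)).
- move=> w; split=> [pw|[x <-]]; last exact: pi0.
  exists (tmapr r w); rewrite -[RHS]dec; have -> : tmapr p w = 0 := pw.
  by rewrite (morphD0 (tmaprD hl)) addr0.
- by move=> z; exists (tmapr h z); apply: (tmapr_cancel hl pl ph).
Qed.

End TensorSplit.

Section KernelRetraction.
Context (R : comPzRingType) (C D : dgAlg R) (M N : dgBimod C D).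
Context (f : dgbHom M N) (h : N -> M).
Hypothesis hl : llinear h.
Hypothesis fhf : forall x, f (h (f x)) = f x.

Lemma ker_retr_proof (x : M) : f (x - h (f x)) = 0.
Proof. by rewrite (dghD f) (morphDN (dghD f)) fhf subrr. Qed.

Definition ker_retr (x : M) : kerBimod f := mkKer (ker_retr_proof x).

Lemma ker_retr_llinear : llinear ker_retr.
Proof.
split=> [x y|c x]; apply: kval_inj; rewrite /=.
  by rewrite (dghD f) hl.1 opprD addrACA.
by rewrite dgbh_lact hl.2 (lactDr c) (morphDN (lactDr c)).
Qed.

Lemma ker_retrK : cancel (ker_incl f) ker_retr.
Proof.
by move=> x; apply: kval_inj; rewrite /= kvalP (morphD0 hl.1) subr0.
Qed.

End KernelRetraction.

Section Bar.
Context (R : comPzRingType) (A B : dgAlg R) (phi : dgAlgHom A B).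
Local Notation barB := (barBimod phi).
Local Notation barT := (barT phi).

(** * Left-linear contraction of the bar resolution *)

Definition bar_append (n : nat) (t : barB n) : barB n.+1 :=
  (ind_pure phi t 1 : barB n.+1) *~ (-1) ^+ n.

Lemma bar_append_llinear n : llinear (@bar_append n).
Proof.
have [appD appl] := bar_app_llinear phi n 1.
split=> [x y|b x]; rewrite /bar_append.
  by rewrite [ind_pure _ _ _]appD mulrzDl.
by rewrite [ind_pure _ _ _]appl (morphDMz (lactDr b)).
Qed.

Lemma bar_d_append0 (t : barB 0) : bar_dB phi 0 (bar_append t) = t.
Proof. by rewrite [bar_dB _ _ _]bar_d0_pure; apply: (@ract1 R B (regMod B)). Qed.

(** The faces that do not touch the appended factor contribute ± d t ⊗ 1; the
    last one multiplies by 1 and gives back t, its sign being cancelled by that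
    of [bar_append]. *)
Lemma bar_d_append n (t : barB n.+1) :
  bar_dB phi n.+1 (bar_append t) + bar_append (bar_dB phi n t) = t.
Proof.
have sgn2 : (-1 : int) ^+ n.+1 * (-1) ^+ n.+1 = 1.
  by rewrite -exprMn mulrNN mulr1 expr1n.
rewrite (morphDMz (dghD (bar_dB phi n.+1))) [bar_dB _ _ _]bar_dS_pure ract1.
rewrite mulrzDl -mulrzA sgn2 mulr1z /bar_append addrAC.
by rewrite [in X in X + _ + _]exprS mulN1r mulrNz addNr add0r.
Qed.

Lemma bar_d_append_d n (t : barB n.+1) :
  bar_dB phi n (bar_append (bar_dB phi n t)) = bar_dB phi n t.
Proof.
case: n t => [|n] t; first exact: bar_d_append0.
rewrite -[RHS]bar_d_append [bar_dB phi n _]bar_d_d.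
by rewrite (morphD0 (bar_append_llinear n).1) addr0.
Qed.

(** * Exactness of the sequences *)

Definition id_bhom (L : dgBimod B B) : dgbHom L L :=
  @DGBHom R B B L L
    (@DGHom R B L L id (fun _ _ => erefl) (fun _ _ => erefl) (fun _ _ => id)
      (fun _ => erefl)) (fun _ _ => erefl).

(** [J_incl] extended to ^0 J, where it is the identity of B; this allows the
    case n = 0 to be treated with the others. *)
Definition J_emb (n : nat) : dgbHom (J phi n) (barB n) :=
  match n return dgbHom (J phi n) (barB n) with
  | 0 => id_bhom (barB 0)
  | n'.+1 => J_incl phi n'
  end.

Lemma J_emb_dJ n t : J_emb n (bar_dJ phi n t) = bar_dB phi n t.
Proof. by case: n t. Qed.

Lemma J_emb_inj n : injective (J_emb n).
Proof. by case: n => [x y //|n]; apply: kval_inj. Qed.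

Definition J_append n (u : J phi n) : barB n.+1 := bar_append (J_emb n u).

Lemma J_append_llinear n : llinear (@J_append n).
Proof.
have [aD al] := bar_append_llinear n.
by split=> [x y|b x]; rewrite /J_append ?dghD ?aD // dgbh_lact al.
Qed.

Lemma J_appendK n : cancel (@J_append n) (bar_dJ phi n).
Proof.
move=> u; apply: J_emb_inj; rewrite J_emb_dJ.
case: n u => [|n] u; first exact: bar_d_append0.
rewrite -[RHS]bar_d_append [bar_dB phi n _]kvalP.
by rewrite (morphD0 (bar_append_llinear n).1) addr0.
Qed.

Lemma J_short_exact (M : dgMod B) n :
  short_exact (tmaprH M (J_incl phi n)) (tmaprH M (bar_dJ phi n)).
Proof.
have hl := bar_append_llinear n.
apply: (@tensor_short_exact _ _ _ M _ _ _ _ _ (ker_retr (@bar_d_append_d n))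
  (@J_append n)).
- exact: ker_retr_llinear.
- exact: J_append_llinear.
- exact: ker_retrK.
- exact: J_appendK.
- move=> x; apply: J_emb_inj; rewrite J_emb_dJ (morphD0 (dghD (J_emb n))).
  exact: kvalP.
- by move=> y; rewrite /J_append J_emb_dJ /= subrK.
Qed.

Lemma tmapr_J_emb_inj (M : dgMod B) n : injective (tmaprH M (J_emb n)).
Proof.
case: n => [x y|n]; last by case: (J_short_exact M n).
by rewrite /= !tmapr_id.
Qed.

Section Module.
Context (N : dgMod B).

Lemma ses_short_exact n : short_exact (ses_f phi N n) (ses_g phi N n).
Proof.
have [inj ex surj] := J_short_exact N n; split.
- by move=> x y /(can_inj (@identK _ _ _ phi N n.+1)) /inj.
- move=> y; split=> [/ex [x xy]|[x <-]].
    by exists x; rewrite [LHS](congr1 (ident phi N n.+1) xy) ident_invK.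
  by apply/ex; exists x; rewrite [RHS]identK.
- move=> z; have [w <-] := surj z; exists (ident phi N n.+1 w).
  by congr (tmaprH N (bar_dJ phi n) _); apply: identK.
Qed.

Lemma ident_J_ses_g n (t : barT N n.+1) :
  ident phi N n (tmaprH N (J_emb n) (ses_g phi N n t)) = bar_d phi N n t.
Proof.
rewrite -[in RHS](ident_invK t) -ident_bar_d; congr (ident phi N n _).
apply: (tmapr_comp_eq (dgbh_llinear _) (dgbh_llinear _) (dgbh_llinear _)).
exact: J_emb_dJ.
Qed.

Lemma bar_d_ident_J n (z : tensor N (J phi n.+1)) :
  bar_d phi N n (ident phi N n.+1 (tmaprH N (J_emb n.+1) z)) = 0.
Proof.
have [_ ex _] := J_short_exact N n.
rewrite -(ident_J_ses_g (n := n)).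
have -> : ses_g phi N n (ident phi N n.+1 (tmaprH N (J_emb n.+1) z)) = 0.
  by apply/ex; exists z; rewrite [RHS]identK.
by rewrite !(morphD0 (dghD _)).
Qed.

(** * The contraction given by a section of π_N *)

Section Homotopy.
Context (s : dgHom N (barT N 1)).
Hypothesis sK : forall x, bar_d phi N 0 (s x) = x.

Fixpoint bar_homotopy (n : nat) : dgHom (barT N n) (barT N n.+1) :=
  match n return dgHom (barT N n) (barT N n.+1) with
  | 0 => s
  | n'.+1 => ind_hom phi (bar_homotopy n')
  end.

Lemma bar_homotopy_pure n (u : barT N n) b :
  bar_homotopy n.+1 (ind_pure phi u b : barT N n.+1) =
  (ind_pure phi (bar_homotopy n u) b : barT N n.+2).
Proof. exact: (ind_map_pure phi (dgh_rlinear (bar_homotopy n))). Qed.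

(** On u ⊗ b the last faces of d σ and of σ d both give σ(u) b, with opposite
    signs; the remaining ones are the same identity for u, tensored with b. *)
Lemma bar_homotopy_contract n (t : barT N n.+1) :
  bar_d phi N n.+1 (bar_homotopy n.+1 t) + bar_homotopy n (bar_d phi N n t) = t.
Proof.
elim: n t => [|n IH] t.
  apply: (@ind_eq _ _ _ phi N (barT N 1) (fun t =>
    bar_d phi N 1 (bar_homotopy 1 t) + bar_homotopy 0 (bar_d phi N 0 t)) id) => //.
    by move=> x y; rewrite !dghD addrACA.
  move=> x b; rewrite bar_homotopy_pure bar_dS_pure bar_d0_pure sK.
  by rewrite (dgh_ract s) expr1 mulrN1z subrK.
apply: (@ind_eq _ _ _ phi (barT N n.+1) (barT N n.+2) (fun t =>
  bar_d phi N n.+2 (bar_homotopy n.+2 t) +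
  bar_homotopy n.+1 (bar_d phi N n.+1 t)) id) => //.
  by move=> x y; rewrite !dghD addrACA.
move=> u b; rewrite bar_homotopy_pure !bar_dS_pure dghD bar_homotopy_pure.
rewrite (morphDMz (dghD (bar_homotopy n.+1))) dgh_ract addrACA.
rewrite -(@ind_pureDl _ _ _ phi (barT N n.+1) b) IH.
by rewrite [in X in _ + (X + _)]exprS mulN1r mulrNz addNr addr0.
Qed.

(** In N ⊗_A B^{⊗ n}, where N ⊗_B ^n J embeds, the n-th surjection becomes d;
    there d σ = 1 on cycles, hence on the image of N ⊗_B ^n J. *)
Lemma ses_g_split n : split_epi (ses_g phi N n).
Proof.
pose e := dgcomp (ident phi N n) (tmaprH N (J_emb n)).
have e_inj : injective e.
  by move=> x y /(can_inj (@identK _ _ _ phi N n)) /(@tmapr_J_emb_inj N n).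
exists (dgcomp (bar_homotopy n) e) => z; apply: e_inj.
rewrite [LHS]ident_J_ses_g {}/e; case: n z => [|n] z; first exact: sK.
rewrite -[RHS]bar_homotopy_contract [bar_d phi N n _]bar_d_ident_J.
by rewrite (morphD0 (dghD _)) addr0.
Qed.

End Homotopy.

Lemma bar_d0_piN (t : barT N 1) : bar_d phi N 0 t = piN phi N t.
Proof. by rewrite /= /bar_d_fun big_ord1 expr0 mulr1z. Qed.

Lemma split_epi_bar_d0 : split_epi (ses_g phi N 0) -> split_epi (bar_d phi N 0).
Proof.
case=> s sK; exists (dgcomp s (ident_inv phi N 0)) => x.
rewrite -(ident_J_ses_g (n := 0)) [ses_g _ _ _ _]sK.
by rewrite [tmaprH _ _ _]tmapr_id [LHS]ident_invK.
Qed.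

End Module.
End Bar.

Theorem theoremA8 (R : comPzRingType) (A B : dgAlg R) (phi : dgAlgHom A B)
    (semifreeB : semifree (resMod phi (regMod B)))
    (N : dgMod B) (semifreeN : semifree N) :
  (naively_liftable phi N <-> split_epi (bar_d phi N 0)) /\
  (split_epi (bar_d phi N 0) <-> bar_split_exact phi N).
Proof.
split; split.
- by case=> s sK; exists s => x; rewrite bar_d0_piN.
- by case=> s sK; exists s => x; rewrite -bar_d0_piN.
- case=> s sK n; split; first exact: ses_short_exact.
  exact: (ses_g_split sK).
- by move=> /(_ 0) [_]; apply: split_epi_bar_d0.
Qed.
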